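(* There exist a finitely presented group $\mathcal{G} = \langle S : R\rangle$ (with $S$ and $R$ finite), a word $w \in \mathcal{F}(S)$ which is non-trivial in $\mathcal{G}$, and constants $\alpha, C, C' > 0$ such that $$\mathrm{hlp}(w;\delta,\epsilon) \;\geq\; C' \cdot \exp\left[ C\cdot \left(\frac{\delta}{\epsilon}\right)^{\alpha}\right]$$ for all $\epsilon, \delta > 0$.
   Context: $\mathcal{F}(S)$ denotes the free group on $S$, and $\mathcal{U}(\mathbb{C}^d)$ is the group of $d\times d$ unitary matrices. A word $w\in\mathcal{F}(S)$ is trivial in $\mathcal{G}=\langle S:R\rangle$ if its image in $\mathcal{G}$ is the identity. For a $d\times d$ complex matrix $A$, $\|A\|_f := \sqrt{\mathrm{tr}(A^*A)/d}$ is the normalized Frobenius norm. For a finitely presented group $\mathcal{G} = \langle S : R\rangle$, with relations regarded as words $r \in R \subset \mathcal{F}(S)$, a $d$-dimensional $\epsilon$-representation of $\mathcal{G}$ is a group homomorphism $\phi:\mathcal{F}(S)\to\mathcal{U}(\mathbb{C}^d)$ such that $\|\phi(r)-\mathbb{1}\|_f\le\epsilon$ for all $r\in R$. For $w\in\mathcal{F}(S)$ and $\delta,\epsilon>0$, $\mathrm{hlp}(w;\delta,\epsilon)$ is the smallest integer $d \geq 1$ for which there is a $d$-dimensional $\epsilon$-representation $\phi$ of $\mathcal{G}$ with $\|\phi(w)-\mathbb{1}\|_f\ge\delta$, or $+\infty$ if no such $d$ exists. (The value $+\infty$ satisfies every lower bound.) *)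

(* Defs.v *)
From HB Require Import structures.
From mathcomp Require Import all_boot all_order all_algebra.
From mathcomp Require Import generic_quotient.
From mathcomp Require Import spectral sesquilinear.
From mathcomp Require Import complex.
From mathcomp Require Import boolp reals constructive_ereal.

Set Implicit Arguments.
Unset Strict Implicit.
Unset Printing Implicit Defensive.

Import Order.TTheory GRing.Theory Num.Theory.

Local Open Scope group_scope.

(* The letter (s, false) stands for the generator s and (s, true) for s^-1.
   Elements of the free group are the freely reduced sequences of letters. *)
Section FreeGroup.
Variable S : choiceType.

Definition letter_inv (x : S * bool) : S * bool := (x.1, ~~ x.2).

Definition reduced (u : seq (S * bool)) : bool :=
  sorted (fun x y => y != letter_inv x) u.

Definition push (x : S * bool) (u : seq (S * bool)) : seq (S * bool) :=
  if u is y :: u' then if y == letter_inv x then u' else x :: u else [:: x].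

Lemma letter_invK : involutive letter_inv.
Proof. by case=> s b; rewrite /letter_inv /= negbK. Qed.

Lemma reduced_push x u : reduced u -> reduced (push x u).
Proof.
case: u => [|y u] //= ru; case: eqVneq => [_|yx]; first exact: path_sorted ru.
by rewrite /= yx.
Qed.

Lemma push_cancel x u : reduced u -> push x (push (letter_inv x) u) = u.
Proof.
case: u => [|y u] /= ru; first by rewrite eqxx.
rewrite letter_invK; case: eqVneq => [yx|_] /=; last by rewrite eqxx.
case: u ru => [|z u] /=; first by rewrite yx.
by rewrite yx => /andP[/negPf->].
Qed.

Lemma reduced_mul u v : reduced v -> reduced (foldr push v u).
Proof. by move=> rv; elim: u => //= x u; exact: reduced_push. Qed.

Lemma reduced_mul1 u : reduced u -> foldr push [::] u = u.
Proof.
elim: u => //= x u IH ru; rewrite (IH (path_sorted ru)).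
by case: u ru {IH} => //= y u /andP[/negPf->].
Qed.

Lemma foldr_push x u v : reduced v ->
  foldr push v (push x u) = push x (foldr push v u).
Proof.
move=> rv; case: u => //= y u; case: eqVneq => [->|_] //=.
by rewrite push_cancel // reduced_mul.
Qed.

Definition inv_seq (u : seq (S * bool)) := rev (map letter_inv u).

Lemma reduced_inv u : reduced u -> reduced (inv_seq u).
Proof.
rewrite /reduced /inv_seq rev_sorted sorted_map; apply: sub_sorted => x y /=.
by rewrite letter_invK eq_sym.
Qed.

Lemma mul_inv_seq u v : reduced v ->
  foldr push (foldr push v u) (inv_seq u) = v.
Proof.
rewrite /inv_seq; elim: u v => //= x u IH v rv.
rewrite rev_cons foldr_rcons -{2}(letter_invK x) push_cancel ?IH //.
exact: reduced_mul.
Qed.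

Definition free_group : Type := {u : seq (S * bool) | reduced u}.
HB.instance Definition _ := Choice.on free_group.

Definition free_one : free_group := exist _ [::] isT.
Definition free_mul (u v : free_group) : free_group :=
  exist _ (foldr push (val v) (val u)) (reduced_mul (val u) (valP v)).
Definition free_inv (u : free_group) : free_group :=
  exist _ (inv_seq (val u)) (reduced_inv (valP u)).

Fact free_mulA : associative free_mul.
Proof.
move=> u v w; apply: val_inj => /=; elim: (val u) => //= x s ->.
by rewrite foldr_push // (valP w).
Qed.
Fact free_mul1 : left_id free_one free_mul.
Proof. by move=> u; apply: val_inj. Qed.
Fact free_mulr1 : right_id free_one free_mul.
Proof. by move=> u; apply: val_inj; rewrite /= reduced_mul1 // (valP u). Qed.
Fact free_mulV : left_inverse free_one free_inv free_mul.
Proof.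
move=> u; apply: val_inj => /=.
by rewrite -{1}(reduced_mul1 (valP u)) mul_inv_seq.
Qed.
Fact free_mulrV : right_inverse free_one free_inv free_mul.
Proof.
move=> u; have vK : free_inv (free_inv u) = u.
  apply: val_inj; rewrite /= /inv_seq map_rev revK -map_comp.
  by rewrite (eq_map letter_invK) map_id.
by rewrite -{1}vK free_mulV.
Qed.

HB.instance Definition _ := isGroup.Build free_group
  free_mulA free_mul1 free_mulr1 free_mulV free_mulrV.

End FreeGroup.

Section Presentation.
Variables (S : choiceType) (Rel : seq (free_group S)).

Inductive normal_closure : free_group S -> Prop :=
| ncl_rel r : r \in Rel -> normal_closure r
| ncl_one : normal_closure 1
| ncl_mul u v : normal_closure u -> normal_closure v -> normal_closure (u * v)
| ncl_inv u : normal_closure u -> normal_closure u^-1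
| ncl_conj u g : normal_closure u -> normal_closure (u ^ g).

Definition pres_rel (u v : free_group S) : bool :=
  `[< normal_closure (u^-1 * v) >].

Fact pres_rel_refl : reflexive pres_rel.
Proof. by move=> u; apply/asboolP; rewrite mulVg; exact: ncl_one. Qed.
Fact pres_rel_sym : symmetric pres_rel.
Proof.
move=> u v; apply/asboolP/asboolP => /ncl_inv; by rewrite invgM invgK.
Qed.
Fact pres_rel_trans : transitive pres_rel.
Proof.
move=> v u w /asboolP uv /asboolP vw; apply/asboolP.
by have := ncl_mul uv vw; rewrite mulgA mulgK.
Qed.
Canonical pres_equiv :=
  EquivRel pres_rel pres_rel_refl pres_rel_sym pres_rel_trans.

Definition presented_group : Type := {eq_quot pres_equiv}%qT.
HB.instance Definition _ := Choice.on presented_group.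

Definition pres_pi (u : free_group S) : presented_group :=
  (\pi_{eq_quot pres_equiv} u)%qT.

Lemma pres_piP u v : pres_pi u = pres_pi v <-> normal_closure (u^-1 * v).
Proof.
rewrite /pres_pi; split=> [/eqquotP/asboolP//|h].
by apply/eqquotP/asboolP.
Qed.

Let pres_repr (x : presented_group) : free_group S :=
  repr (x : {eq_quot pres_equiv}%qT).

Lemma pres_reprK x : pres_pi (pres_repr x) = x.
Proof. exact: reprK. Qed.

Definition pres_mul (x y : presented_group) : presented_group :=
  pres_pi (pres_repr x * pres_repr y).
Definition pres_inv (x : presented_group) : presented_group :=
  pres_pi (pres_repr x)^-1.

Lemma pres_piM u v : pres_pi (u * v) = pres_mul (pres_pi u) (pres_pi v).
Proof.
set u' := pres_repr (pres_pi u); set v' := pres_repr (pres_pi v).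
have /pres_piP hu : pres_pi u = pres_pi u' by rewrite pres_reprK.
have /pres_piP hv : pres_pi v = pres_pi v' by rewrite pres_reprK.
apply/pres_piP; have := ncl_mul (ncl_conj v hu) hv.
by rewrite /conjg invgM !mulgA mulgK.
Qed.

Lemma pres_piV u : pres_pi u^-1 = pres_inv (pres_pi u).
Proof.
set u' := pres_repr (pres_pi u).
have /pres_piP hu : pres_pi u' = pres_pi u by rewrite pres_reprK.
apply/pres_piP; have := ncl_conj u^-1 hu.
by rewrite /conjg !invgK !mulgA mulgK.
Qed.

Fact pres_mulA : associative pres_mul.
Proof.
move=> x y z; rewrite -(pres_reprK x) -(pres_reprK y) -(pres_reprK z).
by rewrite -!pres_piM mulgA.
Qed.
Fact pres_mul1 : left_id (pres_pi 1) pres_mul.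
Proof. by move=> x; rewrite -(pres_reprK x) -pres_piM mul1g. Qed.
Fact pres_mulr1 : right_id (pres_pi 1) pres_mul.
Proof. by move=> x; rewrite -(pres_reprK x) -pres_piM mulg1. Qed.
Fact pres_mulV : left_inverse (pres_pi 1) pres_inv pres_mul.
Proof. by move=> x; rewrite -(pres_reprK x) -pres_piV -pres_piM mulVg. Qed.
Fact pres_mulrV : right_inverse (pres_pi 1) pres_inv pres_mul.
Proof. by move=> x; rewrite -(pres_reprK x) -pres_piV -pres_piM mulgV. Qed.

HB.instance Definition _ := isGroup.Build presented_group
  pres_mulA pres_mul1 pres_mulr1 pres_mulV pres_mulrV.

HB.instance Definition _ := isMultiplicative.Build
  (free_group S) presented_group pres_pi pres_piM.

End Presentation.

Section UnitaryGroup.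
Variables (C : numClosedFieldType) (d : nat).
Local Open Scope ring_scope.
Local Open Scope sesquilinear_scope.

Definition unitary_group : Type := {M : 'M[C]_d | M \is unitarymx}.
HB.instance Definition _ := Choice.on unitary_group.

Fact unitarymx1 : (1%:M : 'M[C]_d) \is unitarymx.
Proof. by apply/unitarymxP; rewrite trmx1 map_mx1 mulmx1. Qed.

Fact unitarymxV (M : 'M[C]_d) : M \is unitarymx -> M ^t* \is unitarymx.
Proof. by rewrite trmxC_unitary. Qed.

Definition unitary_one : unitary_group := exist _ 1%:M unitarymx1.
Definition unitary_mul (U V : unitary_group) : unitary_group :=
  exist _ (val U *m val V) (mul_unitarymx (valP U) (valP V)).
Definition unitary_inv (U : unitary_group) : unitary_group :=
  exist _ ((val U) ^t*) (unitarymxV (valP U)).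

Fact unitary_mulA : associative unitary_mul.
Proof. by move=> U V W; apply: val_inj; rewrite /= mulmxA. Qed.
Fact unitary_mul1 : left_id unitary_one unitary_mul.
Proof. by move=> U; apply: val_inj; rewrite /= mul1mx. Qed.
Fact unitary_mulr1 : right_id unitary_one unitary_mul.
Proof. by move=> U; apply: val_inj; rewrite /= mulmx1. Qed.
Fact unitary_mulrV : right_inverse unitary_one unitary_inv unitary_mul.
Proof. by move=> U; apply: val_inj; apply/unitarymxP/(valP U). Qed.
Fact unitary_mulV : left_inverse unitary_one unitary_inv unitary_mul.
Proof.
by move=> U; apply: val_inj; apply: mulmx1C; apply/unitarymxP/(valP U).
Qed.

HB.instance Definition _ := isGroup.Build unitary_group
  unitary_mulA unitary_mul1 unitary_mulr1 unitary_mulV unitary_mulrV.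

End UnitaryGroup.

Section HyperlinearProfile.
Variable R : realType.
Local Open Scope ring_scope.
Local Open Scope sesquilinear_scope.

(* \tr (A^* A) is a nonnegative real element of R[i], hence the use of Re. *)
Definition fnorm (d : nat) (A : 'M[R[i]]_d) : R :=
  Num.sqrt (complex.Re (\tr (A ^t* *m A)) / d%:R).

Variables (S : choiceType) (Rel : seq (free_group S)).

Definition eps_representation (d : nat) (eps : R)
    (phi : {multiplicative free_group S -> unitary_group R[i] d}) : Prop :=
  forall r, r \in Rel -> fnorm (val (phi r) - 1%:M) <= eps.

Definition hlp_dim (w : free_group S) (delta eps : R) (d : nat) : Prop :=
  (1 <= d)%N /\
  exists phi : {multiplicative free_group S -> unitary_group R[i] d},
    eps_representation eps phi /\ delta <= fnorm (val (phi w) - 1%:M).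

Definition hlp (w : free_group S) (delta eps : R) : \bar R :=
  match pselect (exists d, `[< hlp_dim w delta eps d >]) with
  | left ex_d => (ex_minn ex_d)%:R%:E
  | right _ => +oo%E
  end.

End HyperlinearProfile.

(* Main.v *)
Require Import Defs.
From HB Require Import structures.
From mathcomp Require Import all_boot all_order all_algebra.
From mathcomp Require Import spectral sesquilinear complex.
From mathcomp Require Import boolp reals constructive_ereal sequences exp.
From mathcomp Require Import zify ring lra.

Set Implicit Arguments.
Unset Strict Implicit.
Unset Printing Implicit Defensive.

Import Order.TTheory GRing.Theory Num.Theory.

(** Let e_ij(x) be the elementary 4x4 matrices acting on the triples (p, q, r),
seen as the columns (p, q, r, 1).  The group is generated by the unipotents
a = e12(1), c = e13(1), f = e23(1), g = e32(1), b = e24(1), e = e34(1) and by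
three scalings: d halves q, h halves r, u triples p.  The relators are the
obvious identities between these maps, together with [a, b] = 1, which kills
e14(1).  All of them act on triples as translations of p by elements of
Z[1/3], and so does their normal closure.  The word w = e14(1/2) translates p
by 1/2, which is not in Z[1/3], so w is not trivial (half_word_neq1).

The elements e12(i), e24(j / 2^m) and e14(l / 2^m), for integers i, j, l, obey
the multiplication rules of a Heisenberg group over Z/2^m, up to the fact that
only the central coordinate l is cyclic.  The word w is the element of order 2
of the centre, and a representation in which the centre acts by a character
with w = -1 has dimension at least 2^m.  Two things make this quantitative.

The multiplication rules have short proofs.  Conjugation by d doubles or halves
the entries, hence Horner's scheme writes all the elements above as words of
length O(m).  The rules for these words follow from O(m^4) uses of the relators
(heisenberg_mul, e14w_mod_add), so they hold up to O(m^4 eps) in every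
eps-representation.  In the subgroup generated by a and d alone the commutation
of e12(1) with e12(2^s) has a cost exponential in s.  Here e12(2^s) is also
[e13(1), e32(2^s)], and e12(1) commutes with e13(1) and, as it commutes with g
and h, with e32(2^s) at a linear cost.  The same device applies to e24, and
e14(x) = [e12(1), e24(x)] = [e13(1), e34(x)] commutes with a, b and d, because
each of them commutes with e13(1) and with e34(x).  Finally e14(n) = 1 for an
integer n is obtained by writing n in base 3: conjugation by u multiplies the
argument of e14 by 3 without amplifying the error, which squaring would do.

The dimension bound is stable.  If unitaries U(i, j) and Y(l) of dimension n
satisfy the Heisenberg rules up to an error of at most |Y(w) - 1| / 6, both in
the normalized Frobenius norm, then n is at least a constant times 2^m; the
ratio 6 does not depend on m (approx_heisenberg_card).  The proof
pairs the family U with the exact representations of the Heisenberg group of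
the characters with w = -1 and compares both sides of an inequality for a
threefold convolution (conv_trilinear).

An eps-representation that moves w by delta satisfies the hypotheses as soon as
m^4 eps is smaller than a constant times delta.  With m of the order of
(delta / eps)^(1/4) this gives the theorem, with alpha = 1/4. *)

(** * Approximate equality in a group *)

Local Open Scope group_scope.

(* Decides identities of free groups, by normalizing both sides. *)
Ltac gsimp := by rewrite
  ?(invgM, invgK, mulgA, mulgK, mulgVK, mulVg, mulgV, mul1g, mulg1, invg1).

(** A graded congruence: ap n x y is meant to say that x and y differ by at most
n conjugates of relators, or that their images under a unitary approximation are
at distance at most n * eps. Only the bookkeeping of costs matters for the group
theoretic part of the argument. *)
Record approx_congruence (G : groupType) := ApproxCongruence {
  ap :> nat -> G -> G -> Prop;
  ap_refl : forall x, ap 0 x x;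
  ap_sym : forall n x y, ap n x y -> ap n y x;
  ap_trans : forall m n x y z, ap m x y -> ap n y z -> ap (m + n) x z;
  ap_leq : forall m n x y, m <= n -> ap m x y -> ap n x y;
  ap_mul : forall m n x y x' y',
    ap m x y -> ap n x' y' -> ap (m + n) (x * x') (y * y')
}.

Reserved Notation "x ~[ n ] y" (at level 70, n at level 200, no associativity).

Section ApproxCongruence.
Variables (G : groupType) (E : approx_congruence G).
Implicit Types x y z p q t s : G.
Local Notation "x ~[ n ] y" := (ap E n%N x y).

Lemma ap_ctx p q n x y : x ~[n] y -> p * x * q ~[n] p * y * q.
Proof.
move=> h; have := ap_mul (ap_mul (ap_refl E p) h) (ap_refl E q).
by rewrite add0n addn0.
Qed.

(** One step of a calculation: an approximate identity is used inside a word u,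
at the place given by p and q. *)
Lemma ap_step p q m n u x y v :
  x ~[m] y -> u = p * x * q -> p * y * q ~[n] v -> u ~[m + n] v.
Proof. by move=> h ->; apply: ap_trans; apply: ap_ctx. Qed.

Lemma ap_end p q m u x y v :
  x ~[m] y -> u = p * x * q -> v = p * y * q -> u ~[m] v.
Proof. by move=> h -> ->; apply: ap_ctx. Qed.

Lemma ap_eq n x y : x = y -> x ~[n] y.
Proof. by move=> ->; apply: ap_leq (ap_refl E y). Qed.

Lemma ap_inv n x y : x ~[n] y -> x^-1 ~[n] y^-1.
Proof.
by move=> /ap_sym h; apply: (ap_end (p := x^-1) (q := y^-1) h); gsimp.
Qed.

Definition comm n x y := x * y ~[n] y * x.

Lemma commC n x y : comm n x y -> comm n y x.
Proof. exact: ap_sym. Qed.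

Lemma comm_leq m n x y : m <= n -> comm m x y -> comm n x y.
Proof. exact: ap_leq. Qed.

Lemma comm1 x : comm 0 x 1.
Proof. rewrite /comm mulg1 mul1g; exact: ap_refl. Qed.

Lemma commxx x : comm 0 x x.
Proof. exact: ap_refl. Qed.

Lemma commM m n x y z : comm m x y -> comm n x z -> comm (m + n) x (y * z).
Proof.
move=> hy hz; apply: (ap_step (p := 1) (q := z) hy); first gsimp.
by apply: (ap_end (p := y) (q := 1) hz); gsimp.
Qed.

Lemma commV n x y : comm n x y -> comm n x y^-1.
Proof.
by move=> /ap_sym h; apply: (ap_end (p := y^-1) (q := y^-1) h); gsimp.
Qed.

Lemma commX m n x y : comm m x y -> comm (n * m) x (y ^+ n).
Proof.
move=> xy; elim: n => [|n IH]; first exact: comm1.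
by rewrite expgS mulSn; apply: commM.
Qed.

Lemma commXb n x y (b : bool) : comm n x y -> comm n x (y ^+ b).
Proof. by case: b => // h; apply: comm_leq (comm1 x). Qed.

Lemma commJ m n x y t :
  comm m x t -> comm n x y -> comm (m + (n + m)) x (t * y * t^-1).
Proof.
move=> ht hy; rewrite -mulgA; apply: commM => //; apply: commM => //.
exact: commV.
Qed.

Lemma comm_ap m n x y z : y ~[m] z -> comm n x y -> comm (n + m + m) x z.
Proof.
move=> h c; apply: (@comm_leq (m + (n + m))); first lia.
apply: (ap_step (p := x) (q := 1) (ap_sym h)); first gsimp.
apply: (ap_step (p := 1) (q := 1) c); first gsimp.
by apply: (ap_end (p := 1) (q := x) h); gsimp.
Qed.

End ApproxCongruence.

(** * Horner words *)

Section Horner.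
Variable G : groupType.
Implicit Types t s : G.

(** If conjugation by t squares s, these words are short expressions of the
powers of s: one conjugation for each binary digit of the exponent. *)
Fixpoint horner_fuel t s k n : G :=
  if k is k'.+1 then t * horner_fuel t s k' n./2 * t^-1 * s ^+ odd n else 1.

Definition horner_word t s n := horner_fuel t s n n.

Lemma horner_fuel0 t s k : horner_fuel t s k 0 = 1.
Proof. by elim: k => //= k ->; rewrite expg0; gsimp. Qed.

Lemma horner_fuelE t s k n : n <= k -> horner_fuel t s k n = horner_word t s n.
Proof.
rewrite /horner_word; elim/ltn_ind: n k => -[|n] IH k nk.
  exact: horner_fuel0.
case: k nk => // k nk /=; congr (_ * _ * _ * _).
have h : uphalf n <= n by lia.
by rewrite (IH _ _ k) ?(IH _ _ n) //; apply: leq_trans h _.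
Qed.

Lemma horner_word0 t s : horner_word t s 0 = 1. Proof. by []. Qed.

Lemma horner_wordE t s (c : bool) n :
  horner_word t s (c + n.*2) = t * horner_word t s n * t^-1 * s ^+ c.
Proof.
case: (posnP (c + n.*2)) => [h|h].
  have [-> ->] : n = 0 /\ c = false by lia.
  rewrite !horner_word0 expg0; gsimp.
rewrite {1}/horner_word; move Dk : (c + n.*2) h => k.
case: k Dk => // k Dk _ /=.
have -> : ~~ odd k = c by lia.
have -> : uphalf k = n by lia.
by rewrite horner_fuelE //; lia.
Qed.

Lemma horner_word1 t s : horner_word t s 1 = s.
Proof. by rewrite (horner_wordE t s true 0) horner_word0 expg1; gsimp. Qed.

Lemma horner_word_double t s n :
  horner_word t s n.*2 = t * horner_word t s n * t^-1.
Proof. by rewrite (horner_wordE t s false n) expg0 mulg1. Qed.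

(** Induction on binary digits. The number k of digits is carried along because
all costs are polynomials in k. *)
Lemma binary_ind (P : nat -> nat -> Prop) :
  (forall k, P k 0) ->
  (forall k n (c : bool), n < 2 ^ k -> P k n -> P k.+1 (c + n.*2)) ->
  forall k n, n < 2 ^ k -> P k n.
Proof.
move=> P0 PS; elim=> [|k IH] n.
  by rewrite expn0 ltnS leqn0 => /eqP->.
rewrite -{2}(odd_double_half n) expnS => hn.
have h : n./2 < 2 ^ k by lia.
exact: PS (IH _ h).
Qed.

Lemma horner_word_doubleX t s k n :
  horner_word t s (n * 2 ^ k) = t ^+ k * horner_word t s n * t ^- k.
Proof.
elim: k => [|k IH]; first by rewrite muln1 expg0; gsimp.
rewrite expnS mulnCA mul2n horner_word_double IH !expgS.
gsimp.
Qed.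

End Horner.

(** * The cost of calculations with Horner words *)

Section ApproxHorner.
Variables (G : groupType) (E : approx_congruence G).
Implicit Types x y t s : G.
Local Notation "x ~[ n ] y" := (ap E n%N x y).
Local Notation comm := (comm E).

Lemma comm_horner_word p x t s k n : comm p x t -> comm p x s ->
  n < 2 ^ k -> comm (3 * p * k) x (horner_word t s n).
Proof.
move=> xt xs; move: k n; apply: binary_ind => [k|k n c _ IH].
  by apply: comm_leq (comm1 E x).
rewrite horner_wordE; apply: (@comm_leq _ _ (p + (3 * p * k + p) + p)); first lia.
by apply: commM (commXb _ xs); apply: commJ.
Qed.


(** An identity [x, y] = y' is propagated by conjugations: if T commutes with x,
and acts on y as t and on y' as t', then [x, t y t^-1] = t' y' t'^-1. The cost
of the identity is not multiplied, only increased by the cost of the comparison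
of T with t and t'. *)
Lemma conj_transfer x T t t' y y' i j n : comm 1 x T ->
  comm i (T^-1 * t) y -> comm j (T^-1 * t') y' ->
  x * y * x^-1 * y^-1 ~[n] y' ->
  x * (t * y * t^-1) * x^-1 * (t * y * t^-1)^-1 ~[i + i + j + n + 2]
    t' * y' * t'^-1.
Proof.
move=> xT ty ty' h.
have hy : t * y * t^-1 ~[i] T * y * T^-1.
  by apply: (ap_end (p := T) (q := t^-1) ty); gsimp.
have hy' : T * y' * T^-1 ~[j] t' * y' * t'^-1.
  by apply: (ap_end (p := T) (q := t'^-1) (ap_sym ty')); gsimp.
apply: (@ap_leq _ _ (i + (i + (1 + (1 + (n + j)))))); first lia.
apply: (ap_step (p := x) (q := x^-1 * (t * y * t^-1)^-1) hy); first gsimp.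
apply: (ap_step (p := x * (T * y * T^-1) * x^-1) (q := 1) (ap_inv hy)).
  gsimp.
apply: (ap_step (p := 1) (q := y * T^-1 * x^-1 * T * y^-1 * T^-1) xT).
  gsimp.
apply: (ap_step (p := T * x * y) (q := T * y^-1 * T^-1) (ap_inv xT)).
  gsimp.
apply: (ap_step (p := T) (q := T^-1) h); first gsimp.
by apply: (ap_end (p := 1) (q := 1) hy'); gsimp.
Qed.

(** Commutation with x turns powers of s into powers of s' = [x, s], at
quadratic cost. The exponents grow by conjugation with T, which commutes with x
but acts on s and s' in the same way as t and t'. *)
Lemma horner_word_transfer x T t s t' s' :
  comm 1 x T -> x * s * x^-1 * s^-1 ~[1] s' ->
  comm 1 s' t -> comm 1 s' s ->
  comm 3 (T^-1 * t) t -> comm 3 (T^-1 * t) s ->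
  comm 3 (T^-1 * t') t' -> comm 3 (T^-1 * t') s' ->
  forall k n, n < 2 ^ k ->
  x * horner_word t s n * x^-1 * (horner_word t s n)^-1 ~[30 * k ^ 2]
    horner_word t' s' n.
Proof.
move=> xT xs st ss Dt Ds D't D's.
apply: binary_ind => [k|k n c kn IH].
  apply: ap_eq; rewrite !horner_word0; gsimp.
rewrite !horner_wordE.
have := conj_transfer xT (comm_horner_word Dt Ds kn)
  (comm_horner_word D't D's kn) IH.
set y := horner_word t s n; set y' := horner_word t' s' n => h1.
set Y := t * y * t^-1 in h1 *.
have h2 : Y * (x * s ^+ c * x^-1 * s ^- c) * Y^-1 ~[3 * k + 3] s' ^+ c.
  case: c.
    rewrite !expg1.
    apply: (@ap_leq _ _ (1 + (1 + (3 * 1 * k + 1)))); first lia.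
    apply: (ap_step (p := Y) (q := Y^-1) xs); first gsimp.
    have := commJ st (comm_horner_word st ss kn); rewrite -/y -/Y => /ap_sym sY.
    by apply: (ap_end (p := 1) (q := Y^-1) sY); gsimp.
  apply: ap_eq; rewrite !expg0; gsimp.
have := ap_mul h1 h2.
rewrite (_ : _ * (Y * _ * Y^-1) = x * (Y * s ^+ c) * x^-1 * (Y * s ^+ c)^-1).
  by apply: ap_leq; lia.
gsimp.
Qed.

(** Commutation of s' with its own exponentially large powers. These are also
the [x, y], where y is a word in t and s, and s' commutes with x, t and s. *)
Lemma horner_word_selfcomm x T t s t' s' :
  comm 1 x T -> x * s * x^-1 * s^-1 ~[1] s' ->
  comm 1 s' t -> comm 1 s' s -> comm 1 s' x ->
  comm 3 (T^-1 * t) t -> comm 3 (T^-1 * t) s ->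
  comm 3 (T^-1 * t') t' -> comm 3 (T^-1 * t') s' ->
  forall k n, n < 2 ^ k -> comm (70 * k ^ 2) s' (horner_word t' s' n).
Proof.
move=> xT xs st ss sx Dt Ds D't D's [|k] n kn.
  by rewrite (_ : n = 0); [apply: comm1 | lia].
have h := horner_word_transfer xT xs st ss Dt Ds D't D's kn.
have sy := comm_horner_word st ss kn.
have := comm_ap h (commM (commM (commM sx sy) (commV sx)) (commV sy)).
by apply: comm_leq; lia.
Qed.

Section Add.
Variables t s : G.
Hypothesis tst : t * s * t^-1 ~[1] s * s.
Hypothesis sH :
  forall k n, n < 2 ^ k -> comm (70 * k ^ 2) s (horner_word t s n).

(** The carry of the addition of 1: a digit 1 followed by s gives s * s, which
is the conjugate of s by t. *)
Lemma horner_word_succ k n : n < 2 ^ k ->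
  horner_word t s n * s ~[k] horner_word t s n.+1.
Proof.
move: k n; apply: binary_ind => [k|k n c kn IH].
  by apply: ap_eq; rewrite horner_word0 horner_word1 mul1g.
case: c; last first.
  have -> : (false + n.*2).+1 = true + n.*2 by lia.
  by apply: ap_eq; rewrite !horner_wordE expg0 mulg1.
rewrite horner_wordE expg1.
have -> : (true + n.*2).+1 = (n.+1).*2 by lia.
rewrite horner_word_double.
apply: (ap_step (p := t * horner_word t s n * t^-1) (q := 1) (ap_sym tst)).
  gsimp.
by apply: (ap_end (p := t) (q := t^-1) IH); gsimp.
Qed.

(** Addition with carry. The only expensive step is to move the last digit of
the first number across the other digits of the second one, by the
self-commutation, so that the total cost is cubic. *)
Lemma horner_word_add k m n : m < 2 ^ k -> n < 2 ^ k ->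
  horner_word t s m * horner_word t s n ~[72 * k ^ 3] horner_word t s (m + n).
Proof.
elim: k m n => [|k IH] m n.
  rewrite expn0 !ltnS !leqn0 => /eqP-> /eqP->.
  by apply: ap_eq; rewrite addn0 horner_word0 mulg1.
rewrite -(odd_double_half m) -(odd_double_half n) expnS.
set i := m./2; set j := n./2; set p := odd m; set q := odd n => hi hj.
have hij : i + j < 2 ^ k.+1 by rewrite expnS; lia.
have {}IH : horner_word t s i * horner_word t s j ~[72 * k ^ 3]
    horner_word t s (i + j).
  by apply: IH; lia.
have spj : comm (70 * k.+1 ^ 2) (s ^+ p) (t * horner_word t s j * t^-1).
  rewrite -horner_word_double; apply/commC/commXb/commC/sH.
  rewrite expnS; lia.
apply: (@ap_leq _ _ (70 * k.+1 ^ 2 + (72 * k ^ 3 + k.+2))); first lia.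
rewrite !horner_wordE.
apply: (ap_step (p := t * horner_word t s i * t^-1) (q := s ^+ q) spj); first gsimp.
apply: (ap_step (p := t) (q := t^-1 * s ^+ p * s ^+ q) IH); first gsimp.
case: p q {spj hi hj} => [] [].
- have -> : (true + i.*2 + (true + j.*2)) = ((i + j).+1).*2 by lia.
  rewrite horner_word_double !expg1.
  apply: (@ap_leq _ _ (1 + k.+1)); first lia.
  apply: (ap_step (p := t * horner_word t s (i + j) * t^-1) (q := 1) (ap_sym tst)).
    gsimp.
  by apply: (ap_end (p := t) (q := t^-1) (horner_word_succ hij)); gsimp.
- have -> : (true + i.*2 + (false + j.*2)) = true + (i + j).*2 by lia.
  apply: ap_eq; rewrite horner_wordE expg0; gsimp.
- have -> : (false + i.*2 + (true + j.*2)) = true + (i + j).*2 by lia.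
  apply: ap_eq; rewrite horner_wordE expg0; gsimp.
have -> : (false + i.*2 + (false + j.*2)) = false + (i + j).*2 by lia.
apply: ap_eq; rewrite horner_wordE expg0; gsimp.
Qed.

End Add.
End ApproxHorner.

(** * Relations of elementary matrices *)

Section Relations.
Variable G : groupType.
Variables a b c e f g d h u : G.

(** With columns (p, q, r, 1): a = e12(1), c = e13(1), f = e23(1), g = e32(1), b
= e24(1), e = e34(1), while d and h halve q and r, and u triples p. The pair (a,
b) is the one that does not commute as a pair of affine maps. *)
Definition commuting_pairs : seq (G * G) :=
  [:: (d, c); (d, e); (d, h); (d, u); (h, a); (h, b); (h * d, f); (h * d, g);
      (a, e); (a, c); (a, g); (a, b); (c, b); (b, e); (b, f); (u, b)].

Definition equations : seq (G * G) :=
  [:: (d * a * d^-1, a * a); (d^-1 * b * d, b * b);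
      (a * f * a^-1 * f^-1, c); (f * e * f^-1 * e^-1, b);
      (c * g * c^-1 * g^-1, a); (u * a * u^-1, a * a * a)].

Definition relations : seq (G * G) :=
  [seq (p.1 * p.2, p.2 * p.1) | p <- commuting_pairs] ++ equations.

End Relations.

(** The word for e24(n / 2^m), since conjugation by d^-1 doubles e24. Both this
definition and the next one are locked because the normalization of group words
would otherwise look inside them. *)
HB.lock Definition e24w (G : groupType) (b d : G) m n :=
  d ^+ m * horner_word d^-1 b n * d ^- m.

(** The word for e14(n / 2^m), as a commutator of e12(1) and e24(n / 2^m). *)
HB.lock Definition e14w (G : groupType) (a b d : G) m n :=
  (e24w b d m n)^-1 * a * e24w b d m n * a^-1.

Section ApproxHeisenberg.
Variables (G : groupType) (E : approx_congruence G).
Variables a b c e f g d h u : G.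
Local Notation "x ~[ n ] y" := (ap E n%N x y).
Local Notation comm := (comm E).

Hypothesis rel :
  forall p, p \in relations a b c e f g d h u -> p.1 ~[1] p.2.

Let rel_comm x y : (x, y) \in commuting_pairs a b c e f g d h u -> comm 1 x y.
Proof.
move=> xy; apply: (rel (p := (x * y, y * x))).
by rewrite mem_cat (map_f (fun p => (p.1 * p.2, p.2 * p.1)) xy).
Qed.

Let rel_eq x y : (x, y) \in equations a b c e f g d u -> x ~[1] y.
Proof. by move=> xy; apply: (rel (p := (x, y))); rewrite mem_cat xy orbT. Qed.

Ltac inrel := by rewrite !inE !eqxx ?orbT.

Let dc : comm 1 d c. Proof. apply: rel_comm; inrel. Qed.
Let de : comm 1 d e. Proof. apply: rel_comm; inrel. Qed.
Let dh : comm 1 d h. Proof. apply: rel_comm; inrel. Qed.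
Let du : comm 1 d u. Proof. apply: rel_comm; inrel. Qed.
Let ha : comm 1 h a. Proof. apply: rel_comm; inrel. Qed.
Let hb : comm 1 h b. Proof. apply: rel_comm; inrel. Qed.
Let hdf : comm 1 (h * d) f. Proof. apply: rel_comm; inrel. Qed.
Let hdg : comm 1 (h * d) g. Proof. apply: rel_comm; inrel. Qed.
Let ae : comm 1 a e. Proof. apply: rel_comm; inrel. Qed.
Let ac : comm 1 a c. Proof. apply: rel_comm; inrel. Qed.
Let ag : comm 1 a g. Proof. apply: rel_comm; inrel. Qed.
Let ab : comm 1 a b. Proof. apply: rel_comm; inrel. Qed.
Let cb : comm 1 c b. Proof. apply: rel_comm; inrel. Qed.
Let be : comm 1 b e. Proof. apply: rel_comm; inrel. Qed.
Let bf : comm 1 b f. Proof. apply: rel_comm; inrel. Qed.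
Let ub : comm 1 u b. Proof. apply: rel_comm; inrel. Qed.
Let da : d * a * d^-1 ~[1] a * a. Proof. apply: rel_eq; inrel. Qed.
Let db : d^-1 * b * d ~[1] b * b. Proof. apply: rel_eq; inrel. Qed.
Let afc : a * f * a^-1 * f^-1 ~[1] c. Proof. apply: rel_eq; inrel. Qed.
Let feb : f * e * f^-1 * e^-1 ~[1] b. Proof. apply: rel_eq; inrel. Qed.
Let cga : c * g * c^-1 * g^-1 ~[1] a. Proof. apply: rel_eq; inrel. Qed.
Let ua : u * a * u^-1 ~[1] a * a * a. Proof. apply: rel_eq; inrel. Qed.

(** The word for e12(n). *)
Definition e12w n := horner_word d a n.

Let commVl n x y : comm n x y -> comm n x^-1 y.
Proof. by move=> xy; apply/commC/commV/commC. Qed.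

Let commMl m n x y z : comm m x z -> comm n y z -> comm (m + n) (x * y) z.
Proof. by move=> xz yz; apply/commC/commM; apply/commC. Qed.

(** Here x = e13(1) and s = e32(1). The entry of e32 is doubled by h^-1, but
also by d, which commutes with e13(1) and doubles e12 as well. *)
Let e12w_selfcomm k n : n < 2 ^ k -> comm (70 * k ^ 2) a (e12w n).
Proof.
have hh : comm 3 (d^-1 * h^-1) h^-1.
  apply: (@comm_leq _ _ (1 + 0)) => //; apply: commMl (commxx _ _).
  exact/commV/commVl.
have hg : comm 3 (d^-1 * h^-1) g.
  rewrite -invgM; apply/commVl; exact: comm_leq hdg.
have one3 x : comm 3 (d^-1 * d) x.
  by rewrite mulVg; apply/commC; apply: comm_leq (comm1 E x).
exact: (horner_word_selfcomm (commC dc) cga (commV (commC ha)) ag ac hh hg).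
Qed.

(* For x = e23(1) and s = e34(1) the role of T is played by (h d)^-1, which
   fixes e23 and doubles both e34 and e24. *)
Let hdh3 x : comm 1 d x -> comm 3 (((h * d)^-1)^-1 * h^-1) x.
Proof.
move=> dx; have E1 : d ~[1] h * d * h^-1.
  by apply: (ap_end (p := 1) (q := h^-1) dh); gsimp.
by rewrite invgK; apply: commC; apply: (comm_ap E1 (commC dx)).
Qed.

Let hdd3 x : comm 1 h x -> comm 3 (((h * d)^-1)^-1 * d^-1) x.
Proof. by move=> hx; rewrite invgK mulgK; apply: comm_leq hx. Qed.

(** The words for e34(n) and e24(n). *)
Definition e34int n := horner_word h^-1 e n.
Definition e24int n := horner_word d^-1 b n.

Let e24int_transfer k n : n < 2 ^ k ->
  f * e34int n * f^-1 * (e34int n)^-1 ~[30 * k ^ 2] e24int n.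
Proof.
exact: (horner_word_transfer (commV (commC hdf)) feb (commV (commC hb)) be
  (hdh3 (commV dh)) (hdh3 de) (hdd3 (commV (commC dh))) (hdd3 hb)).
Qed.

Let e24int_selfcomm k n : n < 2 ^ k -> comm (70 * k ^ 2) b (e24int n).
Proof.
exact: (horner_word_selfcomm (commV (commC hdf)) feb (commV (commC hb)) be bf
  (hdh3 (commV dh)) (hdh3 de) (hdd3 (commV (commC dh))) (hdd3 hb)).
Qed.

Let e12w_add k m n : m < 2 ^ k -> n < 2 ^ k ->
  e12w m * e12w n ~[72 * k ^ 3] e12w (m + n).
Proof. exact: (horner_word_add da e12w_selfcomm). Qed.

Let e24int_add k m n : m < 2 ^ k -> n < 2 ^ k ->
  e24int m * e24int n ~[72 * k ^ 3] e24int (m + n).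
Proof. by apply: (horner_word_add _ e24int_selfcomm); rewrite invgK. Qed.

Variables (m K : nat).
Hypotheses (K0 : 0 < K) (mK : m <= K).

Local Notation e24w n := (e24w b d m n%N).
Local Notation e14w n := (e14w a b d m n%N).

(** The word for e34(n / 2^m). *)
Definition e34w n := h ^+ m * e34int n * h ^- m.

Let e24wE n : e24w n = d ^+ m * e24int n * d ^- m.
Proof. by rewrite e24w.unlock. Qed.

Let e14wE n : e14w n = (e24w n)^-1 * a * e24w n * a^-1.
Proof. by rewrite e14w.unlock. Qed.

Let comm_shift p x t t' s n : comm p x t -> comm p x t' -> comm p x s ->
  n < 2 ^ K -> comm (5 * p * K) x (t ^+ m * horner_word t' s n * t ^- m).
Proof.
move=> xt xt' xs nK.
have := commJ (commX m xt) (comm_horner_word xt' xs nK).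
by apply: comm_leq; nia.
Qed.

Let comm_e24w p x n : comm p x d -> comm p x b -> n < 2 ^ K ->
  comm (5 * p * K) x (e24w n).
Proof. by move=> xd xb nK; rewrite e24wE; apply: comm_shift => //; apply: commV. Qed.

Let comm_e34w p x n : comm p x h -> comm p x e -> n < 2 ^ K ->
  comm (5 * p * K) x (e34w n).
Proof. by move=> xd xb nK; apply: comm_shift => //; apply: commV. Qed.

(** e24(n / 2^m) = [e23(1), e34(n / 2^m)], from the case m = 0 by m conjugations
with h d, which commutes with e23(1). *)
Let e24w_transfer n : n < 2 ^ K ->
  f * e34w n * f^-1 * (e34w n)^-1 ~[77 * K ^ 2] e24w n.
Proof.
move=> nK; rewrite /e34w e24wE.
have shift (t y : G) j :
    t ^+ j.+1 * y * t ^- j.+1 = t * (t ^+ j * y * t ^- j) * t^-1.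
  by rewrite expgS; gsimp.
suff key j : j <= K ->
    f * (h ^+ j * e34int n * h ^- j) * f^-1 *
      (h ^+ j * e34int n * h ^- j)^-1 ~[30 * K ^ 2 + 47 * K * j]
    d ^+ j * e24int n * d ^- j.
  by apply: ap_leq (key m mK); nia.
elim: j => [|j IH] jK.
  by rewrite !expg0 !invg1 !mulg1 !mul1g; apply: ap_leq (e24int_transfer nK);
     lia.
rewrite !shift.
have hy p x : comm p x h -> comm p x e ->
    comm (5 * p * K) x (h ^+ j * e34int n * h ^- j).
  move=> xh xe.
  have := commJ (commX j xh) (comm_horner_word (commV xh) xe nK).
  by apply: comm_leq; nia.
have hy' p x : comm p x d -> comm p x b ->
    comm (5 * p * K) x (d ^+ j * e24int n * d ^- j).
  move=> xd xb.
  have := commJ (commX j xd) (comm_horner_word (commV xd) xb nK).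
  by apply: comm_leq; nia.
have hd1 x : comm 1 d x -> comm 1 ((h * d)^-1 * h) x.
  by move=> dx; rewrite invgM -mulgA mulVg mulg1; apply: commVl.
have dhd x : comm 1 h x -> comm 3 ((h * d)^-1 * d) x.
  move=> hx; have h1 : h^-1 ~[1] (h * d)^-1 * d.
    by apply: (ap_end (p := d^-1 * h^-1) (q := h^-1) (ap_sym dh)); gsimp.
  by apply/commC; apply: (comm_ap (n := 1) h1); apply/commC/commVl.
have := conj_transfer (commC hdf) (hy _ _ (hd1 _ dh) (hd1 _ de))
  (hy' _ _ (dhd _ (commC dh)) (dhd _ hb)) (IH (ltnW jK)).
by apply: ap_leq; nia.
Qed.

(** The second expression of the central element, [e13(1), e34(x)] = [e12(1),
e24(x)], where e24(x) is expanded as [e23(1), e34(x)] and e12(1) is moved across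
it. *)
Let e14w_transfer n : n < 2 ^ K ->
  e14w n ~[171 * K ^ 2] c * e34w n * c^-1 * (e34w n)^-1.
Proof.
move=> nK; have fw := e24w_transfer nK; rewrite e14wE.
have aw := comm_e34w (commC ha) ae nK.
have cbe := comm_e24w (commC dc) cb nK.
set w := e34w n in fw aw *; set be_n := e24w n in fw cbe *.
have af : a * f ~[1] c * f * a.
  by apply: (ap_end (p := 1) (q := f * a) afc); gsimp.
apply: (@ap_leq _ _ (77 * K ^ 2 + (1 + (5 * 1 * K + (5 * 1 * K + (1 +
  (77 * K ^ 2 + 5 * 1 * K))))))); first nia.
apply: (ap_step (p := be_n^-1 * a) (q := a^-1) (ap_sym fw)); first gsimp.
apply: (ap_step (p := be_n^-1) (q := w * f^-1 * w^-1 * a^-1) af); first gsimp.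
apply: (ap_step (p := be_n^-1 * c * f) (q := f^-1 * w^-1 * a^-1) aw).
  gsimp.
apply: (ap_step (p := be_n^-1 * c * f * w * a * f^-1) (q := 1)
  (ap_inv aw)); first gsimp.
apply: (ap_step (p := be_n^-1 * c * f * w * a) (q := w^-1) (ap_inv af)).
  gsimp.
apply: (ap_step (p := be_n^-1 * c) (q := w * c^-1 * w^-1) fw); first gsimp.
by apply: (ap_end (p := be_n^-1) (q := w * c^-1 * w^-1) cbe); gsimp.
Qed.

(** The centrality of e14, tested on x: it is enough that x commutes with e13
and e34. *)
Let comm_e14w x n : comm 1 x c -> comm (5 * 1 * K) x (e34w n) -> n < 2 ^ K ->
  comm (354 * K ^ 2) x (e14w n).
Proof.
move=> xc xw nK.
have := comm_ap (ap_sym (e14w_transfer nK))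
  (commM (commM (commM xc xw) (commV xc)) (commV xw)).
by apply: comm_leq; nia.
Qed.

Let e14w_a n : n < 2 ^ K -> comm (354 * K ^ 2) a (e14w n).
Proof.
by move=> nK; apply: (comm_e14w ac _ nK); apply: (comm_e34w (commC ha) ae).
Qed.

Let e14w_b n : n < 2 ^ K -> comm (354 * K ^ 2) b (e14w n).
Proof.
by move=> nK; apply: (comm_e14w (commC cb) _ nK); apply: (comm_e34w (commC hb) be).
Qed.

Let e14w_d n : n < 2 ^ K -> comm (354 * K ^ 2) d (e14w n).
Proof.
by move=> nK; apply: (comm_e14w dc _ nK); apply: (comm_e34w dh de).
Qed.

Let e14w_e12w n i : n < 2 ^ K -> i < 2 ^ K ->
  comm (1062 * K ^ 3) (e14w n) (e12w i).
Proof.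
move=> nK iK.
have := comm_horner_word (commC (e14w_d nK)) (commC (e14w_a nK)) iK.
by apply: comm_leq; nia.
Qed.

Let e14w_e24w n j : n < 2 ^ K -> j < 2 ^ K ->
  comm (1770 * K ^ 3) (e14w n) (e24w j).
Proof.
move=> nK jK.
have := comm_e24w (commC (e14w_d nK)) (commC (e14w_b nK)) jK.
by apply: comm_leq; nia.
Qed.

Let e24w_add i j : i < 2 ^ K -> j < 2 ^ K ->
  e24w i * e24w j ~[72 * K ^ 3] e24w (i + j).
Proof.
move=> iK jK.
by apply: (ap_end (p := d ^+ m) (q := d ^- m) (e24int_add iK jK));
   rewrite !e24wE; gsimp.
Qed.

(** By centrality the commutator with e12(1) is a homomorphism. *)
Let e14w_add i j : i < 2 ^ K -> j < 2 ^ K ->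
  e14w i * e14w j ~[2000 * K ^ 3] e14w (i + j).
Proof.
move=> iK jK.
apply: (@ap_leq _ _ (1770 * K ^ 3 + (72 * K ^ 3 + 72 * K ^ 3))); first nia.
apply: (ap_step (p := (e24w j)^-1) (q := e14w j)
  (x := e24w j * e14w i) (y := e14w i * e24w j)); first exact/commC/e14w_e24w.
  gsimp.
apply: (ap_step (p := 1) (q := a * e24w i * e24w j * a^-1)
  (ap_inv (e24w_add iK jK))); first by rewrite !e14wE; gsimp.
by apply: (ap_end (p := (e24w (i + j))^-1 * a) (q := a^-1)
  (e24w_add iK jK)); rewrite ?e14wE; gsimp.
Qed.

Let e24w0 : e24w 0 = 1.
Proof. rewrite e24wE /e24int horner_word0; gsimp. Qed.

Let e14w0 : e14w 0 = 1.
Proof. rewrite e14wE e24w0; gsimp. Qed.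


Let e24w_double j : e24w j.*2 = d^-1 * e24w j * d.
Proof.
rewrite !e24wE /e24int horner_word_double invgK.
suff dm : d ^+ m * d^-1 = d^-1 * d ^+ m.
  have dm' : d * d ^- m = d ^- m * d.
    by apply: invg_inj; rewrite !invgM invgK.
  by rewrite !mulgA dm -!mulgA dm'.
exact/commute_sym/commuteX/commute_sym/commuteV.
Qed.

(** [e12(i), e24(x)] = e14(i x) by induction on the digits of i. As d fixes e14,
conjugation by d moves a factor 2 from the first argument to the second. *)
Let e12w_e24w k i j : k <= K -> i < 2 ^ k -> j * 2 ^ k < 2 ^ K ->
  e12w i * e24w j ~[52 * 100 * K ^ 3 * k] e14w (i * j) * e24w j * e12w i.
Proof.
move=> kK ik; move: k i ik j kK; apply: binary_ind => [k|k n x kn IH] j kK.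
  by move=> _; apply: ap_eq; rewrite /e12w horner_word0 e14w0; gsimp.
rewrite expnS mulnCA mulnA mul2n => jK; have {}IH := IH _ (ltnW kK) jK.
have k2 : 2 ^ k.+1 <= 2 ^ K by rewrite leq_exp2l.
rewrite expnS in k2.
have jK' : j < 2 ^ K by nia.
have nK : n.*2 < 2 ^ K by lia.
have xjK : x * j < 2 ^ K by case: (x); lia.
have njK : n * j.*2 < 2 ^ K by nia.
have ax : a ^+ x * e24w j ~[1770 * K ^ 3] e14w (x * j) * e24w j * a ^+ x.
  case: (x); last by apply: ap_eq; rewrite expg0 mul0n e14w0; gsimp.
  rewrite expg1 mul1n.
  apply: (ap_end (p := 1) (q := a) (ap_sym (e14w_e24w jK' jK'))).
    by rewrite e14wE; gsimp.
  gsimp.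
apply: (@ap_leq _ _ (1770 * K ^ 3 + (1062 * K ^ 3 + (52 * 100 * K ^ 3 * k +
  (354 * K ^ 2 + 2000 * K ^ 3))))).
  by have := leq_pexp2l K0 (isT : 2 <= 3); nia.
rewrite /e12w horner_wordE -/(e12w n).
apply: (ap_step (p := d * e12w n * d^-1) (q := 1) ax); first gsimp.
have := e14w_e12w xjK nK; rewrite {1}/e12w horner_word_double -/(e12w n) => zx.
apply: (ap_step (p := 1) (q := e24w j * a ^+ x) (ap_sym zx)); first gsimp.
apply: (ap_step (p := e14w (x * j) * d) (q := d^-1 * a ^+ x) IH).
  by rewrite e24w_double; gsimp.
apply: (ap_step (p := e14w (x * j)) (q := e24w j.*2 * e12w n * d^-1 * a ^+ x)
  (e14w_d njK)); first gsimp.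
have -> : ((x + n.*2) * j = x * j + n * j.*2)%N by nia.
apply: (ap_end (p := 1) (q := e24w j * d * e12w n * d^-1 * a ^+ x)
  (e14w_add xjK njK)); rewrite ?e24w_double; gsimp.
Qed.

(** Conjugation by u multiplies the argument of e14 by 3, and it preserves
approximate equality at no cost. *)
Let e14w_cube n : 3 * (n * 2 ^ m) < 2 ^ K ->
  e14w (3 * (n * 2 ^ m)) ~[51 * 100 * K ^ 3] u * e14w (n * 2 ^ m) * u^-1.
Proof.
move=> nK; set l := (n * 2 ^ m)%N in nK *.
have lK : l < 2 ^ K by lia.
have l2K : (l + l < 2 ^ K)%N by lia.
have betal : e24w l = horner_word d^-1 b n.
  rewrite e24wE /e24int /l horner_word_doubleX expVgn; gsimp.
have nK' : n < 2 ^ K.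
  by apply: leq_ltn_trans lK; rewrite leq_pmulr // expn_gt0.
have ubl : comm (3 * 1 * K) u (e24w l).
  rewrite betal; apply: (comm_horner_word _ ub nK'); exact/commV/commC.
have za := e14w_a lK.
have h1 : u * e14w l * u^-1 ~[6 * K + 2 + 3 * (354 * K ^ 2)]
    e14w l * e14w l * e14w l.
  apply: (@ap_leq _ _ (3 * 1 * K + (1 + (3 * 1 * K + (1 + (354 * K ^ 2 +
    (354 * K ^ 2 + 354 * K ^ 2))))))); first lia.
  apply: (ap_step (p := 1) (q := a * e24w l * a^-1 * u^-1) (commV ubl)).
    by rewrite e14wE; gsimp.
  apply: (ap_step (p := (e24w l)^-1) (q := u * e24w l * a^-1 * u^-1) ua).
    gsimp.
  apply: (ap_step (p := (e24w l)^-1 * (a * a * a)) (q := a^-1 * u^-1) ubl).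
    gsimp.
  apply: (ap_step (p := (e24w l)^-1 * (a * a * a) * e24w l) (q := 1)
    (ap_inv ua)); first gsimp.
  apply: (ap_step (p := e14w l) (q := a * e14w l * a^-1 * a^-1) za).
    by rewrite e14wE; gsimp.
  apply: (ap_step (p := e14w l * e14w l * a) (q := a^-1 * a^-1) za).
    gsimp.
  by apply: (ap_end (p := e14w l * e14w l) (q := a^-1) za); gsimp.
apply: (@ap_leq _ _ (2000 * K ^ 3 + (2000 * K ^ 3 +
  (6 * K + 2 + 3 * (354 * K ^ 2))))).
  have := leq_pexp2l K0 (isT : 2 <= 3); have := leq_pexp2l K0 (isT : 1 <= 3).
  by rewrite expn1; move: (K ^ 2)%N (K ^ 3)%N => K2 K3; lia.
have -> : (3 * l = l + l + l)%N by lia.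
apply: (ap_step (p := 1) (q := 1) (ap_sym (e14w_add l2K lK))); first gsimp.
apply: (ap_step (p := 1) (q := e14w l) (ap_sym (e14w_add lK lK))); first gsimp.
by apply: (ap_end (p := 1) (q := 1) (ap_sym h1)); gsimp.
Qed.

Let e24w_int n : e24w (n * 2 ^ m) = e24int n.
Proof. by rewrite e24wE /e24int horner_word_doubleX expVgn; gsimp. Qed.

Let e14w_int_digit r : r < 3 -> 2 * 2 ^ m < 2 ^ K ->
  e14w (r * 2 ^ m) ~[2000 * K ^ 3 + 2] 1.
Proof.
have h1 : e14w (1 * 2 ^ m) ~[1] 1.
  rewrite e14wE e24w_int /e24int horner_word1.
  by apply: (ap_end (p := b^-1) (q := a^-1) ab); gsimp.
case: r => [|[|[|//]]] _ mlK.
- by apply: ap_eq; rewrite mul0n e14w0.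
- by apply: ap_leq h1; lia.
have -> : (2 * 2 ^ m = 1 * 2 ^ m + 1 * 2 ^ m)%N by lia.
apply: (@ap_leq _ _ (2000 * K ^ 3 + (1 + 1))); first lia.
have mK1 : (1 * 2 ^ m < 2 ^ K)%N by lia.
apply: (ap_step (p := 1) (q := 1) (ap_sym (e14w_add mK1 mK1))); first gsimp.
apply: (ap_step (p := 1) (q := e14w (1 * 2 ^ m)) h1); first gsimp.
by apply: (ap_end (p := 1) (q := 1) h1); gsimp.
Qed.

(** e14(q) = 1 for an integer q, one digit of q in base 3 at a time. Passing
from q to 2 q by squaring would double the cost at each step. *)
Let e14w_int k q : q < 3 ^ k -> 2 * 2 ^ m < 2 ^ K -> q * 2 ^ m < 2 ^ K ->
  e14w (q * 2 ^ m) ~[92 * 100 * K ^ 3 * k] 1.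
Proof.
move=> + mlK; elim: k q => [|k IH] q.
  by rewrite expn0 ltnS leqn0 => /eqP-> _; apply: ap_eq; rewrite mul0n e14w0.
rewrite expnS => hq hqK.
have r3 : q %% 3 < 3 by rewrite ltn_mod.
have qE := divn_eq q 3.
set p := q %/ 3 in qE *; set r := q %% 3 in qE r3 *.
have pK : p * 2 ^ m < 2 ^ K by nia.
have p3K : 3 * (p * 2 ^ m) < 2 ^ K by nia.
have rK : r * 2 ^ m < 2 ^ K by nia.
have {}IH : e14w (p * 2 ^ m) ~[92 * 100 * K ^ 3 * k] 1 by apply: IH; lia.
have -> : (q * 2 ^ m = 3 * (p * 2 ^ m) + r * 2 ^ m)%N by rewrite qE; lia.
apply: (@ap_leq _ _ (2000 * K ^ 3 + (51 * 100 * K ^ 3 +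
  (92 * 100 * K ^ 3 * k + (2000 * K ^ 3 + 2))))); first nia.
apply: (ap_step (p := 1) (q := 1) (ap_sym (e14w_add p3K rK))); first gsimp.
apply: (ap_step (p := 1) (q := e14w (r * 2 ^ m)) (e14w_cube p3K)); first gsimp.
apply: (ap_step (p := u) (q := u^-1 * e14w (r * 2 ^ m)) IH); first gsimp.
by apply: (ap_end (p := 1) (q := 1) (e14w_int_digit r3 mlK)); gsimp.
Qed.

Let e14w_mod l : 2 * 2 ^ m < 2 ^ K -> l < 2 ^ K ->
  e14w l ~[112 * 100 * K ^ 4] e14w (l %% 2 ^ m).
Proof.
move=> mlK lK; have lE := divn_eq l (2 ^ m).
set q := l %/ 2 ^ m in lE; set r := l %% 2 ^ m in lE *.
have q2 : q < 2 ^ K by apply: leq_ltn_trans lK; apply: leq_div.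
have q3 : q < 3 ^ K by apply: leq_trans q2 _; rewrite leq_exp2r.
have qK : q * 2 ^ m < 2 ^ K by lia.
have rK : r < 2 ^ K by lia.
have q1 := e14w_int q3 mlK qK.
apply: (@ap_leq _ _ (2000 * K ^ 3 + 92 * 100 * K ^ 3 * K)); first nia.
rewrite {1}lE.
apply: (ap_step (p := 1) (q := 1) (ap_sym (e14w_add qK rK))); first gsimp.
by apply: (ap_end (p := 1) (q := e14w r) q1); gsimp.
Qed.

(** Cyclicity of the centre: as e14 is trivial on integers, only the residue of
the index modulo 2^m matters. *)
Lemma e14w_mod_add i j :
  2 * 2 ^ m < 2 ^ K -> i < 2 ^ m -> j < 2 ^ m ->
  e14w i * e14w j ~[200 * 100 * K ^ 4] e14w ((i + j) %% 2 ^ m).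
Proof.
move=> mlK im jm.
apply: (@ap_leq _ _ (2000 * K ^ 3 + 112 * 100 * K ^ 4)); first nia.
apply: (@ap_trans _ _ _ _ _ (e14w (i + j))).
  by apply: e14w_add; lia.
by apply: e14w_mod => //; lia.
Qed.

(** The multiplication rule of the Heisenberg group. Only the central coordinate
is reduced modulo 2^m. *)
Lemma heisenberg_mul i j i' j' : m.*2 <= K -> 2 * 2 ^ m < 2 ^ K ->
  i < 2 ^ m -> j < 2 ^ m -> i' < 2 ^ m -> j' < 2 ^ m ->
  (e24w j * e12w i) * (e24w j' * e12w i') ~[200 * 100 * K ^ 4]
  e14w ((i * j') %% 2 ^ m) * (e24w (j + j') * e12w (i + i')).
Proof.
move=> m2K mlK im jm im' jm'.
have lt_mK n : n < 2 ^ m -> n < 2 ^ K by lia.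
have ijK : i * j' < 2 ^ K.
  apply: (@leq_trans (2 ^ m * 2 ^ m)); first nia.
  by rewrite -expnD addnn leq_exp2l.
have jK' : j' * 2 ^ m < 2 ^ K.
  apply: (@leq_trans (2 ^ m * 2 ^ m)); first nia.
  by rewrite -expnD addnn leq_exp2l.
apply: (@ap_leq _ _ (52 * 100 * K ^ 3 * m + (1770 * K ^ 3 + (72 * K ^ 3 +
  (72 * K ^ 3 + 112 * 100 * K ^ 4))))).
  have : 52 * 100 * K ^ 3 * m <= 52 * 100 * K ^ 3 * K by rewrite leq_mul2l mK orbT.
  by nia.
apply: (ap_step (p := e24w j) (q := e12w i') (e12w_e24w mK im jK')).
  gsimp.
apply: (ap_step (p := 1) (q := e24w j' * e12w i * e12w i')
  (commC (e14w_e24w ijK (lt_mK _ jm)))); first gsimp.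
apply: (ap_step (p := e14w (i * j')) (q := e12w i * e12w i')
  (e24w_add (lt_mK _ jm) (lt_mK _ jm'))); first gsimp.
apply: (ap_step (p := e14w (i * j') * e24w (j + j')) (q := 1)
  (e12w_add (lt_mK _ im) (lt_mK _ im'))); first gsimp.
by apply: (ap_end (p := 1) (q := e24w (j + j') * e12w (i + i'))
  (e14w_mod mlK ijK)); gsimp.
Qed.

Lemma e14w_half k : m = k.+1 ->
  e14w (2 ^ k) = (d * b * d^-1)^-1 * a * (d * b * d^-1) * a^-1.
Proof.
move=> mk; suff bE : e24w (2 ^ k) = d * b * d^-1 by rewrite e14wE bE.
rewrite e24wE /e24int -(mul1n (2 ^ k)%N) horner_word_doubleX horner_word1.
rewrite mk expgS expVgn.
gsimp.
Qed.

End ApproxHeisenberg.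

Local Close Scope group_scope.

(** * The Hilbert-Schmidt inner product *)

Section HilbertSchmidt.
Variable R : rcfType.
Local Notation C := R[i].
Local Open Scope ring_scope.
Local Open Scope sesquilinear_scope.

Let ReD (x y : C) : complex.Re (x + y) = complex.Re x + complex.Re y.
Proof. by case: x; case: y. Qed.

Lemma Re_sum (I : Type) (r : seq I) (P : pred I) (F : I -> C) :
  complex.Re (\sum_(i <- r | P i) F i) = \sum_(i <- r | P i) complex.Re (F i).
Proof. by elim/big_rec2: _ => // i x y _ <-; rewrite ReD. Qed.

Lemma Re_realM (t : R) (z : C) : complex.Re (t%:C%C * z) = t * complex.Re z.
Proof. by case: z => x y; rewrite /= mul0r subr0. Qed.

Lemma Re_conj (z : C) : complex.Re (z^*)%R = complex.Re z.
Proof. by case: z. Qed.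

Definition hs m n (A B : 'M[C]_(m, n)) : C := \tr (A ^t* *m B).

Lemma hsE m n (A B : 'M[C]_(m, n)) :
  hs A B = \sum_i \sum_j (A i j)^* * B i j.
Proof.
rewrite /hs /mxtrace exchange_big; apply: eq_bigr => j _.
by rewrite mxE; apply: eq_bigr => i _; rewrite !mxE.
Qed.

Lemma hs_conj m n (A B : 'M[C]_(m, n)) : hs B A = (hs A B)^*.
Proof.
rewrite !hsE rmorph_sum; apply: eq_bigr => i _; rewrite rmorph_sum.
by apply: eq_bigr => j _; rewrite rmorphM /= conjCK mulrC.
Qed.

Lemma hs_sumr m n (I : Type) (r : seq I) (P : pred I) A (F : I -> 'M[C]_(m, n)) :
  hs A (\sum_(i <- r | P i) F i) = \sum_(i <- r | P i) hs A (F i).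
Proof. by rewrite /hs mulmx_sumr raddf_sum. Qed.

Lemma hs_suml m n (I : Type) (r : seq I) (P : pred I) A (F : I -> 'M[C]_(m, n)) :
  hs (\sum_(i <- r | P i) F i) A = \sum_(i <- r | P i) hs (F i) A.
Proof.
rewrite hs_conj hs_sumr rmorph_sum; apply: eq_bigr => i _.
by rewrite /= -hs_conj.
Qed.

Lemma hsZr m n c (A B : 'M[C]_(m, n)) : hs A (c *: B) = c * hs A B.
Proof. by rewrite /hs -scalemxAr mxtraceZ. Qed.

Lemma hsZl m n c (A B : 'M[C]_(m, n)) : hs (c *: A) B = c^* * hs A B.
Proof. by rewrite hs_conj hsZr rmorphM /= -hs_conj. Qed.

Lemma hsDr m n (A B D : 'M[C]_(m, n)) : hs A (B + D) = hs A B + hs A D.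
Proof. by rewrite /hs mulmxDr mxtraceD. Qed.

Lemma hsNr m n (A B : 'M[C]_(m, n)) : hs A (- B) = - hs A B.
Proof. by rewrite -scaleN1r hsZr mulN1r. Qed.

Lemma hsDl m n (A B D : 'M[C]_(m, n)) : hs (B + D) A = hs B A + hs D A.
Proof. by rewrite hs_conj hsDr rmorphD /= -!hs_conj. Qed.

Lemma hsNl m n (A B : 'M[C]_(m, n)) : hs (- A) B = - hs A B.
Proof. by rewrite hs_conj hsNr rmorphN /= -hs_conj. Qed.

Lemma hs0r m n (A : 'M[C]_(m, n)) : hs A 0 = 0.
Proof. by rewrite /hs mulmx0 mxtrace0. Qed.

Lemma hs_adjl n (A B D : 'M[C]_n) : hs (A *m B) D = hs B (A^t* *m D).
Proof. by rewrite /hs trmx_mul map_mxM -mulmxA. Qed.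

Lemma hs_adjr n (A B D : 'M[C]_n) : hs (A *m B) D = hs A (D *m B^t*).
Proof.
by rewrite /hs trmx_mul map_mxM -mulmxA mxtrace_mulC mulmxA.
Qed.

Lemma unitarymxPV n (U : 'M[C]_n) : U \is unitarymx -> U^t* *m U = 1%:M.
Proof. by move/unitarymxP/mulmx1C. Qed.

Lemma hs_unitaryl n (U A B : 'M[C]_n) : U \is unitarymx ->
  hs (U *m A) (U *m B) = hs A B.
Proof. by move=> hU; rewrite hs_adjl mulmxA unitarymxPV // mul1mx. Qed.

Lemma hs_unitaryr n (U A B : 'M[C]_n) : U \is unitarymx ->
  hs (A *m U) (B *m U) = hs A B.
Proof. by move=> hU; rewrite hs_adjr -mulmxA (unitarymxP _) // mulmx1. Qed.

(** The real part of the inner product and the square of the Frobenius norm,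
without normalization by the dimension. *)
Definition hsre m n (A B : 'M[C]_(m, n)) : R := complex.Re (hs A B).
Definition nsq m n (A : 'M[C]_(m, n)) : R := hsre A A.

Lemma hsreC m n (A B : 'M[C]_(m, n)) : hsre A B = hsre B A.
Proof. by rewrite /hsre hs_conj Re_conj. Qed.

Lemma nsqE m n (A : 'M[C]_(m, n)) :
  nsq A = \sum_i \sum_j complex.Re `|A i j| ^+ 2.
Proof.
rewrite /nsq /hsre hsE Re_sum; apply: eq_bigr => i _.
rewrite Re_sum; apply: eq_bigr => j _.
by rewrite mulrC -normCK normc_def -rmorphXn.
Qed.

Lemma nsq_ge0 m n (A : 'M[C]_(m, n)) : 0 <= nsq A.
Proof. by rewrite nsqE; do 2![apply: sumr_ge0 => ? _]; exact: sqr_ge0. Qed.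

Lemma nsqD m n (A B : 'M[C]_(m, n)) :
  nsq (A + B) = nsq A + nsq B + 2 * hsre A B.
Proof.
rewrite /nsq {1}/hsre hsDr !hsDl !ReD -/(hsre A B) -/(hsre B A).
by rewrite [hsre B A]hsreC /hsre; ring.
Qed.

Lemma nsqN m n (A : 'M[C]_(m, n)) : nsq (- A) = nsq A.
Proof. by rewrite /nsq /hsre hsNr hsNl opprK. Qed.

Lemma hsreNr m n (A B : 'M[C]_(m, n)) : hsre A (- B) = - hsre A B.
Proof. by rewrite /hsre hsNr; case: (hs A B). Qed.

Lemma nsqB m n (A B : 'M[C]_(m, n)) :
  nsq (A - B) = nsq A + nsq B - 2 * hsre A B.
Proof. by rewrite nsqD nsqN hsreNr mulrN. Qed.

Lemma nsqZ m n (t : R) (A : 'M[C]_(m, n)) : nsq (t%:C%C *: A) = t ^+ 2 * nsq A.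
Proof.
rewrite /nsq /hsre hsZr hsZl Re_realM.
have -> : (t%:C%C)^* = t%:C%C :> C by rewrite -[LHS]/(conjc _) conjc_real.
by rewrite Re_realM mulrA.
Qed.

Lemma hsreZr m n (t : R) (A B : 'M[C]_(m, n)) :
  hsre A (t%:C%C *: B) = t * hsre A B.
Proof. by rewrite /hsre hsZr Re_realM. Qed.

Lemma hsre_young m n (t : R) (A B : 'M[C]_(m, n)) : 0 < t ->
  2 * hsre A B <= t * nsq B + t^-1 * nsq A.
Proof.
move=> t0; have := nsq_ge0 (A - t%:C%C *: B).
rewrite nsqB nsqZ hsreZr => h.
have : 0 <= t^-1 * (nsq A + t ^+ 2 * nsq B - 2 * (t * hsre A B)).
  by rewrite mulr_ge0 // invr_ge0 ltW.
rewrite (_ : _ * _ = t^-1 * nsq A + t * nsq B - 2 * hsre A B); last first.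
  by field; rewrite gt_eqF.
lra.
Qed.

Lemma nsqD_le m n (A B : 'M[C]_(m, n)) : nsq (A + B) <= 2 * (nsq A + nsq B).
Proof. by have := hsre_young A B ltr01; rewrite nsqD invr1; lra. Qed.

Lemma nsqB_le m n (A B : 'M[C]_(m, n)) : nsq (A - B) <= 2 * (nsq A + nsq B).
Proof. by have := nsqD_le A (- B); rewrite nsqN. Qed.

Lemma hsre_close m n r (A B : 'M[C]_(m, n)) : nsq (A - B) <= r ->
  (nsq A + nsq B - r) / 2 <= hsre A B.
Proof. by rewrite nsqB => ?; lra. Qed.

Lemma nsq_unitaryl n (U A : 'M[C]_n) : U \is unitarymx -> nsq (U *m A) = nsq A.
Proof. by move=> hU; rewrite /nsq /hsre hs_unitaryl. Qed.

Lemma nsq_unitaryr n (U A : 'M[C]_n) : U \is unitarymx -> nsq (A *m U) = nsq A.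
Proof. by move=> hU; rewrite /nsq /hsre hs_unitaryr. Qed.

Lemma nsq1 n : nsq (1%:M : 'M[C]_n) = n%:R.
Proof.
rewrite /nsq /hsre /hs trmx1 map_mx1 mul1mx mxtrace1.
by rewrite -[in LHS](rmorph_nat (real_complex R)).
Qed.

Lemma nsq_unitary n (U : 'M[C]_n) : U \is unitarymx -> nsq U = n%:R.
Proof. by move=> hU; rewrite -[U]mulmx1 nsq_unitaryl // nsq1. Qed.

Lemma cauchy_schwarz (I : finType) (x y : I -> R) :
  (\sum_i x i * y i) ^+ 2 <= (\sum_i x i ^+ 2) * (\sum_i y i ^+ 2).
Proof.
have : 0 <= \sum_i \sum_j (x i * y j - x j * y i) ^+ 2.
  by do 2![apply: sumr_ge0 => ? _]; exact: sqr_ge0.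
have -> : \sum_i \sum_j (x i * y j - x j * y i) ^+ 2 =
    \sum_i \sum_j (x i ^+ 2 * y j ^+ 2) + \sum_j \sum_i (x i ^+ 2 * y j ^+ 2)
    - 2 * \sum_i \sum_j ((x i * y i) * (x j * y j)).
  rewrite mulr_sumr -big_split -sumrB; apply: eq_bigr => i _.
  rewrite mulr_sumr -big_split -sumrB; apply: eq_bigr => j _ /=.
  by ring.
rewrite [X in _ + X - _]exchange_big -!big_distrlr /= -expr2.
lra.
Qed.

Lemma cauchy_schwarzC (I : finType) (a b : I -> C) :
  complex.Re `|\sum_i a i * b i| ^+ 2 <=
  (\sum_i complex.Re `|a i| ^+ 2) * (\sum_i complex.Re `|b i| ^+ 2).
Proof.
apply: le_trans (cauchy_schwarz _ _).
have Rn (z : C) : (complex.Re `|z|)%:C%C = `|z| by rewrite normc_def.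
have Rn0 (z : C) : 0 <= complex.Re `|z| by rewrite -ler0c Rn.
rewrite ler_sqr ?nnegrE ?sumr_ge0 // => [|i _]; last exact: mulr_ge0.
rewrite -lecR Rn rmorph_sum; apply: le_trans (ler_norm_sum _ _ _) _.
by apply: ler_sum => i _; rewrite rmorphM /= !Rn normrM.
Qed.

Lemma hsre_le m n (A B : 'M[C]_(m, n)) :
  hsre A B <= Num.sqrt (nsq A) * Num.sqrt (nsq B).
Proof.
have : complex.Re `|hs A B| ^+ 2 <= nsq A * nsq B.
  rewrite hsE !nsqE !pair_bigA; apply: le_trans (cauchy_schwarzC _ _) _.
  by under [X in X * _]eq_bigr do rewrite norm_conjC.
move=> h; apply: (@le_trans _ _ (complex.Re `|hs A B|)).
  by rewrite normc_def /hsre; case: (hs A B) => x y /=;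
     rewrite (le_trans (ler_norm x)) // -sqrtr_sqr ler_wsqrtr // lerDl sqr_ge0.
rewrite -sqrtrM ?nsq_ge0 // -[leLHS]ger0_norm -?sqrtr_sqr ?ler_wsqrtr //.
by rewrite normc_def /= sqrtr_ge0.
Qed.

Lemma sqrt_nsqD m n (A B : 'M[C]_(m, n)) :
  Num.sqrt (nsq (A + B)) <= Num.sqrt (nsq A) + Num.sqrt (nsq B).
Proof.
have hA := sqr_sqrtr (nsq_ge0 A); have hB := sqr_sqrtr (nsq_ge0 B).
rewrite -[leRHS]ger0_norm ?addr_ge0 ?sqrtr_ge0 // -sqrtr_sqr ler_wsqrtr //.
by have := hsre_le A B; rewrite nsqD sqrrD hA hB; lra.
Qed.

(** Submultiplicativity of the Frobenius norm, for a row and a column of blocks.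
*)
Lemma nsq_sum_mul n (K : finType) (X Y : K -> 'M[C]_n) :
  nsq (\sum_k X k *m Y k) <= (\sum_k nsq (X k)) * (\sum_k nsq (Y k)).
Proof.
rewrite nsqE.
have -> : \sum_k nsq (X k) =
    \sum_i \sum_(p : K * 'I_n) complex.Re `|X p.1 i p.2| ^+ 2.
  rewrite (eq_bigr _ (fun k _ => nsqE (X k))) exchange_big.
  by apply: eq_bigr => i _; rewrite pair_big.
have -> : \sum_k nsq (Y k) =
    \sum_j \sum_(p : K * 'I_n) complex.Re `|Y p.1 p.2 j| ^+ 2.
  rewrite (eq_bigr _ (fun k _ => nsqE (Y k))).
  under eq_bigr do rewrite exchange_big.
  rewrite exchange_big; apply: eq_bigr => j _; by rewrite pair_big.
rewrite big_distrlr /=; apply: ler_sum => i _; apply: ler_sum => j _.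
apply: le_trans (cauchy_schwarzC _ _).
have -> // : (\sum_k X k *m Y k) i j =
    \sum_(p : K * 'I_n) X p.1 i p.2 * Y p.1 p.2 j.
by rewrite summxE; under eq_bigr do rewrite mxE; rewrite pair_big.
Qed.

Lemma nsq_mul_adj n r (P V W : 'M[C]_n) : W \is unitarymx ->
  nsq (P - V *m W) <= r -> nsq (P *m W^t* - V) <= r.
Proof.
move=> Wu; suff -> : P *m W^t* - V = (P - V *m W) *m W^t*.
  by rewrite nsq_unitaryr ?trmxC_unitary.
by rewrite mulmxBl -(mulmxA V) (unitarymxP Wu) mulmx1.
Qed.

(** If V Z and V' Z are close to W and W', and X is close to Z, then X carries V
- V' to W - W'. The constant 16 comes from a sum of four errors. *)
Lemma unitary_shift_close n r (V V' W W' X Z : 'M[C]_n) :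
  V \is unitarymx -> V' \is unitarymx -> nsq (X - Z) <= r ->
  nsq (V *m Z - W) <= r -> nsq (V' *m Z - W') <= r ->
  nsq ((V - V') *m X - (W - W')) <= 16 * r.
Proof.
move=> Vu V'u hX hW hW'.
have -> : (V - V') *m X - (W - W') =
    (V *m (X - Z) - V' *m (X - Z)) + ((V *m Z - W) - (V' *m Z - W')).
  by rewrite mulmxBl !mulmxBr; apply/matrixP=> i j; rewrite !mxE; ring.
have := nsqB_le (V *m (X - Z)) (V' *m (X - Z)).
have := nsqB_le (V *m Z - W) (V' *m Z - W').
rewrite !nsq_unitaryl // => h1 h2; apply: le_trans (nsqD_le _ _) _.
by move: h1 h2 hX hW hW'; do !move: (nsq _) => ?; move=> *; lra.
Qed.

(** If V L is close to W, then V and W are about as far from each other as L is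
from the identity. *)
Lemma unitary_shift_far n e D (V L W : 'M[C]_n) :
  V \is unitarymx -> 0 < D -> 36 * e <= D ->
  nsq (V *m L - W) <= e -> D <= nsq (L - 1%:M) -> 16 * e < nsq (V - W).
Proof.
move=> Vu D0 eD hW hL.
have := nsqB_le (V *m L - W) (V - W).
have -> : V *m L - W - (V - W) = V *m (L - 1%:M).
  by rewrite mulmxBr mulmx1 opprB addrA subrK.
rewrite nsq_unitaryl //; move: hW hL.
by do !move: (nsq _) => ?; move=> *; lra.
Qed.

End HilbertSchmidt.

(** * Dimensions of approximate representations of Heisenberg groups *)

Section Trilinear.
Variables (R : rcfType) (A : finZmodType) (n : nat).
Local Notation C := R[i].
Local Open Scope ring_scope.
Implicit Types F T : A -> A -> 'M[C]_n.

(** The matrices of blocks F(j, s), in row s + j and column s, multiply as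
indicated, so that this is the bound |tr (F F' adj T)| <= |F| |F'| |T| of
Frobenius norms, with a parameter t instead of square roots. The dimension n
will enter through |F'| only, F' being made of unitaries; F and T will contain
one and the same projection. *)
Lemma conv_trilinear F F' T (t : R) : 0 < t ->
  2 * \sum_s \sum_j \sum_j' hsre (T (j + j') s) (F j (s + j') *m F' j' s) <=
  t * ((\sum_j \sum_s nsq (F j s)) * (\sum_j \sum_s nsq (F' j s))) +
  t^-1 * \sum_j \sum_s nsq (T j s).
Proof.
move=> t0; pose G J s := \sum_j' F (J - j') (s + j') *m F' j' s.
have -> : \sum_s \sum_j \sum_j' hsre (T (j + j') s) (F j (s + j') *m F' j' s) =
    \sum_s \sum_J hsre (T J s) (G J s).
  apply: eq_bigr => s _; rewrite exchange_big /=.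
  under [RHS]eq_bigr do rewrite /hsre hs_sumr Re_sum.
  rewrite [RHS]exchange_big /=; apply: eq_bigr => j' _.
  rewrite (reindex_inj (addIr (- j'))) /=; apply: eq_bigr => J _.
  by rewrite subrK.
have GF : \sum_s \sum_J nsq (G J s) <=
    (\sum_j \sum_s nsq (F j s)) * (\sum_j \sum_s nsq (F' j s)).
  rewrite [X in _ <= _ * X]exchange_big /= mulr_sumr.
  apply: ler_sum => s _.
  have -> : \sum_j \sum_s nsq (F j s) =
      \sum_J \sum_j' nsq (F (J - j') (s + j')).
    rewrite [RHS]exchange_big /=.
    under [RHS]eq_bigr => j' _.
      rewrite (reindex_inj (addIr j')) /=.
      under eq_bigr do rewrite addrK.
      over.
    rewrite [RHS]exchange_big /=; apply: eq_bigr => j _.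
    by rewrite (reindex_inj (addrI s)).
  rewrite mulr_suml; apply: ler_sum => J _; exact: nsq_sum_mul.
apply: (@le_trans _ _ (\sum_s \sum_J (t * nsq (G J s) + t^-1 * nsq (T J s)))).
  rewrite mulr_sumr; apply: ler_sum => s _; rewrite mulr_sumr.
  by apply: ler_sum => J _; apply: hsre_young.
under eq_bigr do rewrite big_split /= -!mulr_sumr.
rewrite big_split /= -!mulr_sumr [X in _ + _ * X <= _]exchange_big /=.
by rewrite lerD2r ler_pM2l.
Qed.

End Trilinear.

Fact sum_pick (V : nmodType) (T : finType) (a : T) (F : T -> V) :
  (forall i, i != a -> F i = 0%R) -> (\sum_i F i)%R = F a.
Proof. by move=> F0; rewrite (bigD1 a) //= big1 ?addr0. Qed.

Fact inv_square_half (F : numFieldType) (x a b : F) : (x != 0)%R ->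
  (x / 2 * true%:R * (x ^- 2 * a) - x / 2 * true%:R * (x ^- 2 * b) =
    (2 * x)^-1 * (a - b))%R.
Proof. by move=> x0; rewrite (_ : true%:R%R = 1%R :> F) //; field. Qed.

Fact dimension_arith (F : realFieldType) (N I n q t : F) :
  (0 < N -> 0 < n -> 0 < q -> t = (2 * N * n)^-1 ->
  2 * N * (I ^+ 2 * (q / 2)) <=
    t * (N ^+ 2 * I ^+ 2 * n * q) + t^-1 * (N ^+ 3 * q) ->
  I ^+ 2 <= 4 * N ^+ 3 * n)%R.
Proof.
move=> N0 n0 q0 ->; rewrite invrK => h.
have Nq : (0 < N * q / 2)%R by rewrite divr_gt0 ?mulr_gt0.
rewrite -(ler_pM2l Nq) -subr_ge0; move: h; rewrite -subr_ge0.
congr (_ <= _)%R; field.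
by rewrite !gt_eqF.
Qed.

(** Let A be a finite ring with an additive character psi, and let psi_u(x) =
psi(u x). For each u the Heisenberg group of A has an exact representation on
the functions on A, by translations and multiplications by values of psi_u, in
which the centre acts through psi_u. The set O consists of the u for which the
central element lam, with 2 lam = 0, acts by -1; for these u the representation
is irreducible, by lam_reg. *)
Section DimensionBound.
Variables (R : rcfType) (A : finComNzRingType) (n : nat).
Local Notation C := R[i].
Local Open Scope ring_scope.
Local Open Scope sesquilinear_scope.

Variables (psi : A -> C) (lam : A).
Hypotheses (psi0 : psi 0 = 1) (psiD : forall x y, psi (x + y) = psi x * psi y).
Hypothesis psi_conj : forall x, (psi x)^* = psi (- x).
Hypothesis psi_sum : forall x, x != 0 -> \sum_s psi (x * s) = 0.
Hypothesis lam2 : lam + lam = 0.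
Hypothesis lam_reg : forall u x, psi (u * lam) = -1 -> u * x = 0 -> x = 0.

Let O := [pred u | psi (u * lam) == -1].
(* The conjugate character, since the exact representation is paired with the
   approximate one. *)
Let om u x := psi (- (u * x)).
Let N : C := #|A|%:R.

Let sum_psi x : \sum_s psi (x * s) = if x == 0 then N else 0.
Proof.
case: eqP => [->|/eqP/psi_sum//].
by under eq_bigr do rewrite mul0r psi0; rewrite sumr_const.
Qed.

Let om_sum u x : u \in O -> \sum_s om u (x * s) = if x == 0 then N else 0.
Proof.
rewrite inE => /eqP uO.
under eq_bigr do rewrite /om mulrA -mulNr; rewrite sum_psi oppr_eq0.
by case: (x =P 0) => [->|x0]; [rewrite mulr0 eqxx|case: eqP => // /(lam_reg uO)].
Qed.

Let omD u x y : om u (x + y) = om u x * om u y.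
Proof. by rewrite /om mulrDr opprD psiD. Qed.

Let om_conj u x : (om u x)^* = om u (- x).
Proof. by rewrite /om psi_conj mulrN. Qed.

Let parseval u (M : A -> 'M[C]_n) : u \in O ->
  \sum_s nsq (\sum_i om u (i * s) *: M i) = #|A|%:R * \sum_i nsq (M i).
Proof.
move=> uO; rewrite /nsq /hsre -Re_sum.
have -> : \sum_s hs (\sum_i om u (i * s) *: M i) (\sum_i om u (i * s) *: M i) =
    N * \sum_i hs (M i) (M i).
  under eq_bigr do rewrite hs_suml; rewrite exchange_big mulr_sumr /=.
  apply: eq_bigr => i _.
  under eq_bigr do rewrite hs_sumr; rewrite exchange_big /=.
  rewrite (bigD1 i) //= [X in _ + X]big1 ?addr0 => [|k ki].
    under eq_bigr do rewrite hsZl hsZr mulrA om_conj -omD addNr.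
    rewrite -mulr_suml; congr (_ * _).
    rewrite (eq_bigr (fun s => om u (0 * s))) ?om_sum ?eqxx // => s _.
    by rewrite mul0r.
  under eq_bigr do rewrite hsZl hsZr mulrA om_conj -omD -mulNr -mulrDl.
  rewrite -mulr_suml om_sum // addrC subr_eq0 (negPf ki).
  by rewrite mul0r.
rewrite -Re_sum /N -(rmorph_nat (real_complex R)).
by rewrite Re_realM.
Qed.

(** Orthogonality of characters restricted to O: the indicator of O is half of
the difference of the trivial character and of u |-> psi (u lam). *)
Let sumO x : \sum_(u in O) psi (u * x) =
  N / 2 * ((x == 0)%:R - (x == lam)%:R).
Proof.
have sq u : psi (u * lam) = 1 \/ psi (u * lam) = -1.
  have : psi (u * lam) ^+ 2 == 1 by rewrite expr2 -psiD -mulrDr lam2 mulr0 psi0.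
  by rewrite sqrf_eq1 => /orP[] /eqP; [left|right].
have h u : (if u \in O then psi (u * x) else 0) =
    2^-1 * psi (u * x) - 2^-1 * psi (u * (x - lam)).
  have -> : psi (u * (x - lam)) = psi (u * x) * psi (u * lam).
    rewrite -psiD -mulrDr; congr (psi (u * (x + _))).
    by rewrite -[LHS]addr0 -lam2 addKr.
  rewrite inE; case: (sq u) => ->.
    rewrite mulr1 subrr; case: eqP => // /eqP.
    by rewrite -addr_eq0 -(natrD _ 1 1) pnatr_eq0.
  by rewrite eqxx mulrN1 mulrN opprK -mulrDl; field.
rewrite big_mkcond (eq_bigr _ (fun u _ => h u)) sumrB -!mulr_sumr.
have s y : \sum_u psi (u * y) = if y == 0 then N else 0.
  by under eq_bigr do rewrite mulrC; exact: sum_psi.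
rewrite !s subr_eq0; case: (x == 0); case: (x == lam) => /=; by field.
Qed.

Variables (Y : A -> 'M[C]_n) (U : A -> A -> 'M[C]_n) (I : {set A * A}).
Variables (e D : R).
Hypotheses (n0 : (0 < n)%N) (D0 : 0 < D) (eD : 36 * e <= D).
Hypotheses (Yu : forall l, Y l \is unitarymx).
Hypotheses (Uu : forall i j, U i j \is unitarymx).
Hypothesis YM : forall l l', nsq (Y l *m Y l' - Y (l + l')) <= e.
Hypothesis UM : forall i j i' j', (i, j) \in I -> (i', j') \in I ->
  nsq (U i j *m U i' j' - Y (i * j') *m U (i + i') (j + j')) <= e.
Hypothesis Ylam : D <= nsq (Y lam - 1%:M).

(* Q u is the approximate projection to the part on which the centre acts by
   psi_u, and Dl measures the part on which lam does not act trivially. *)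
Let Q u := N^-1 *: \sum_l om u l *: Y l.
Let Dl l := Y l - Y (l + lam).

Let N0 : N != 0.
Proof. by rewrite pnatr_eq0 -lt0n; apply/card_gt0P; exists 0. Qed.

(** Fourier inversion over O. The right-hand side involves the differences Dl
only, so that the errors will be compared with |Y lam - 1| and not with its
square. *)
Let corr x X :
  \sum_(u in O) om u x * hs (Q u) (Q u *m X) =
  (4 * N)^-1 * \sum_l hs (Dl (l + x)) (Dl l *m X).
Proof.
have Nconj : (N^-1)^* = N^-1 by rewrite fmorphV rmorph_nat.
have QE u : om u x * hs (Q u) (Q u *m X) =
    \sum_l \sum_l' psi (u * (l - l' - x)) * (N ^- 2 * hs (Y l) (Y l' *m X)).
  rewrite /Q -scalemxAl hsZl hsZr Nconj hs_suml !mulr_sumr.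
  apply: eq_bigr => l _; rewrite mulmx_suml hs_sumr !mulr_sumr.
  apply: eq_bigr => l' _; rewrite -scalemxAl hsZl hsZr om_conj.
  have -> : psi (u * (l - l' - x)) = om u x * om u (- l) * om u l'.
    by rewrite -!omD /om -mulrN; congr (psi (u * _)); ring.
  by rewrite expr2 invfM; ring.
rewrite (eq_bigr _ (fun u _ => QE u)) exchange_big /=.
under eq_bigr do rewrite exchange_big /=.
rewrite exchange_big /=.
have inner l' : \sum_l \sum_(u in O)
     psi (u * (l - l' - x)) * (N ^- 2 * hs (Y l) (Y l' *m X)) =
    (2 * N)^-1 * hs (Dl (l' + x)) (Y l' *m X).
  under eq_bigr do rewrite -mulr_suml sumO mulrBr mulrBl.
  rewrite sumrB (sum_pick (a := l' + x)) => [|l hl]; last first.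
    by rewrite -addrA -opprD subr_eq0 (negPf hl) mulr0 mul0r.
  rewrite (sum_pick (a := l' + x + lam)) => [|l hl]; last first.
    rewrite -subr_eq0 -!addrA -!opprD subr_eq0 addrA (negPf hl).
    by rewrite mulr0 mul0r.
  rewrite /Dl hsDl hsNl.
  have -> : (l' + x - l' - x == 0) = true by apply/eqP; ring.
  have -> : (l' + x + lam - l' - x == lam) = true by apply/eqP; ring.
  exact: inv_square_half.
rewrite (eq_bigr _ (fun l' _ => inner l')) -mulr_sumr.
suff -> : \sum_l hs (Dl (l + x)) (Dl l *m X) =
    2 * \sum_l hs (Dl (l + x)) (Y l *m X).
  by field.
have DlN l : Dl (l + lam) = - Dl l.
  by rewrite /Dl -addrA lam2 addr0 opprB.
under eq_bigr do rewrite {2}/Dl mulmxBl hsDr hsNr.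
rewrite sumrB [X in _ - X](reindex_inj (addIr lam)) /=.
under [X in _ - X]eq_bigr => l _ do
  rewrite -(addrA l lam lam) lam2 addr0 addrAC DlN hsNl.
by rewrite sumrN opprK -mulr2n mulr_natl.
Qed.

Let NR : R := #|A|%:R.

Let NE : N = NR%:C%C. Proof. by rewrite /NR rmorph_nat. Qed.

Let N4E : (4 * N)^-1 = ((4 * NR)^-1)%:C%C.
Proof. by rewrite NE fmorphV rmorphM (rmorph_nat _ 4). Qed.

Let NR0 : 0 < NR.
Proof. by rewrite ltr0n; apply/card_gt0P; exists 0. Qed.

Let nR0 : 0 < n%:R :> R. Proof. by rewrite ltr0n. Qed.

Let Dl_lower l : 16 * e < nsq (Dl l).
Proof. exact: unitary_shift_far (Yu l) D0 eD (YM l lam) Ylam. Qed.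

(* The total weight of the part on which lam acts by -1. *)
Let qt := \sum_(u in O) nsq (Q u).

Let qtE : qt = (4 * NR)^-1 * \sum_l nsq (Dl l).
Proof.
have := corr 0 1%:M.
under eq_bigr do rewrite /om mulr0 oppr0 psi0 mul1r mulmx1.
under [X in _ = _ * X]eq_bigr do rewrite addr0 mulmx1.
move=> /(congr1 (@complex.Re R)); rewrite Re_sum /qt /nsq /hsre => ->.
by rewrite N4E Re_realM Re_sum.
Qed.

Let corr_lower x X : X \is unitarymx -> nsq (X - Y x) <= e ->
  qt / 2 <= complex.Re (\sum_(u in O) om u x * hs (Q u) (Q u *m X)).
Proof.
move=> Xu hX; rewrite corr qtE.
rewrite N4E Re_realM Re_sum -mulrA ler_pM2l ?invr_gt0 ?mulr_gt0 //.
have close l : nsq (Dl l *m X - Dl (l + x)) <= 16 * e.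
  rewrite /Dl (addrAC l x lam).
  exact: unitary_shift_close (Yu _) (Yu _) hX (YM l x) (YM (l + lam) x).
have low l : (nsq (Dl l) + nsq (Dl (l + x)) - 16 * e) / 2 <=
    hsre (Dl (l + x)) (Dl l *m X).
  rewrite hsreC; apply: le_trans (hsre_close (close l)).
  by rewrite nsq_unitaryr.
apply: le_trans (ler_sum _ (fun l _ => low l)).
rewrite -mulr_suml sumrB big_split /= ler_pM2r ?invr_gt0 //.
rewrite [X in _ + X - _](_ : _ = \sum_l nsq (Dl l)); last first.
  by rewrite [RHS](reindex_inj (addIr x)).
rewrite -[X in X <= _]addr0 -addrA lerD2l subr_ge0.
by apply: ler_sum => l _; exact/ltW/Dl_lower.
Qed.

Let e0 : 0 <= e.
Proof. exact: le_trans (nsq_ge0 _) (YM 0 0). Qed.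

Let qt_gt0 : 0 < qt.
Proof.
rewrite qtE mulr_gt0 ?invr_gt0 ?mulr_gt0 //.
rewrite (bigD1 0) //= ltr_pwDl //; last by apply: sumr_ge0 => l _; apply: nsq_ge0.
by apply: le_lt_trans (Dl_lower 0); rewrite mulr_ge0.
Qed.

(* The blocks of the sums over I, and over A * A for T, of the tensor products
   of the exact representation with Q U, U and Q U. *)
Let UI i j := if (i, j) \in I then U i j else 0.
Let F u j s := \sum_i om u (i * s) *: (Q u *m UI i j).
Let F' u j s := \sum_i om u (i * s) *: UI i j.
Let T u j s := \sum_i om u (i * s) *: (Q u *m U i j).

(** The trace of F F' adj T. The sum over s selects the terms in which the three
group elements multiply to a central one. *)
Let total u : u \in O ->
  \sum_s \sum_j \sum_j' hs (T u (j + j') s) (F u j (s + j') *m F' u j' s) =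
  N * \sum_j \sum_j' \sum_i \sum_i' om u (i * j') *
    hs (Q u *m U (i + i') (j + j')) (Q u *m (UI i j *m UI i' j')).
Proof.
move=> uO; rewrite exchange_big mulr_sumr; apply: eq_bigr => j _.
rewrite exchange_big mulr_sumr; apply: eq_bigr => j' _ /=.
have expand s : hs (T u (j + j') s) (F u j (s + j') *m F' u j' s) =
    \sum_i \sum_i' \sum_p om u ((i + i' - p) * s) * (om u (i * j') *
      hs (Q u *m U p (j + j')) (Q u *m (UI i j *m UI i' j'))).
  rewrite /F /F' mulmx_suml hs_sumr; apply: eq_bigr => i _.
  rewrite mulmx_sumr hs_sumr; apply: eq_bigr => i' _.
  rewrite /T hs_suml; apply: eq_bigr => p _.
  rewrite -scalemxAl -scalemxAr !hsZr hsZl om_conj -mulmxA.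
  rewrite mulrDr !mulrDl !omD mulNr.
  by rewrite -!mulrA; do 3!(congr (_ * _); first by []) || ring.
rewrite (eq_bigr _ (fun s _ => expand s)) exchange_big mulr_sumr.
apply: eq_bigr => i _; rewrite exchange_big mulr_sumr.
apply: eq_bigr => i' _; rewrite exchange_big /=.
rewrite (sum_pick (a := i + i')) => [|p pi].
  by rewrite -mulr_suml om_sum // (subrr (i + i')) (eqxx (0 : A)).
by rewrite -mulr_suml om_sum // subr_eq0 eq_sym (negPf pi) mul0r.
Qed.

Let cardI : \sum_j \sum_i ((i, j) \in I)%:R = #|I|%:R :> R.
Proof.
rewrite exchange_big pair_big /= -sum1_card natr_sum [RHS]big_mkcond.
by apply: eq_bigr => -[i j] _; case: (_ \in I).
Qed.

Let normF u : u \in O ->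
  \sum_j \sum_s nsq (F u j s) = NR * #|I|%:R * nsq (Q u).
Proof.
move=> uO; rewrite -cardI mulr_sumr mulr_suml; apply: eq_bigr => j _.
rewrite parseval // -mulrA mulr_suml; congr (_ * _); apply: eq_bigr => i _.
rewrite /UI; case: ifP => _; first by rewrite nsq_unitaryr // mul1r.
by rewrite mulmx0 mul0r nsqE big1 // => k _; rewrite big1 // => l _;
   rewrite mxE normr0 expr0n.
Qed.

Let normF' u : u \in O ->
  \sum_j \sum_s nsq (F' u j s) = NR * #|I|%:R * n%:R.
Proof.
move=> uO; rewrite -cardI mulr_sumr mulr_suml; apply: eq_bigr => j _.
rewrite parseval // -mulrA mulr_suml; congr (_ * _); apply: eq_bigr => i _.
rewrite /UI; case: ifP => _; first by rewrite nsq_unitary // mul1r.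
by rewrite mul0r nsqE big1 // => k _; rewrite big1 // => l _;
   rewrite mxE normr0 expr0n.
Qed.

Let normT u : u \in O ->
  \sum_j \sum_s nsq (T u j s) = NR ^+ 3 * nsq (Q u).
Proof.
move=> uO; under eq_bigr do rewrite parseval //.
under eq_bigr do under eq_bigr do rewrite nsq_unitaryr //.
rewrite !sumr_const -(mulr_natr (nsq _)) -(mulr_natr (_ * _)) -/NR; ring.
Qed.

(** In each term the phase om u (i * j') cancels the central factor of U U'. *)
Let total_lower : #|I|%:R ^+ 2 * (qt / 2) <=
  \sum_(u in O) complex.Re (\sum_j \sum_j' \sum_i \sum_i' om u (i * j') *
    hs (Q u *m U (i + i') (j + j')) (Q u *m (UI i j *m UI i' j'))).
Proof.
have -> : #|I|%:R ^+ 2 * (qt / 2) = \sum_j \sum_j' \sum_i \sum_i'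
    ((i, j) \in I)%:R * ((i', j') \in I)%:R * (qt / 2) :> R.
  rewrite expr2 -cardI big_distrlr mulr_suml; apply: eq_bigr => j _.
  rewrite mulr_suml; apply: eq_bigr => j' _.
  rewrite big_distrlr mulr_suml; apply: eq_bigr => i _.
  by rewrite mulr_suml.
rewrite -Re_sum [X in complex.Re X]exchange_big Re_sum /=; apply: ler_sum => j _.
rewrite [X in complex.Re X]exchange_big Re_sum /=; apply: ler_sum => j' _.
rewrite [X in complex.Re X]exchange_big Re_sum /=; apply: ler_sum => i _.
rewrite [X in complex.Re X]exchange_big Re_sum /=; apply: ler_sum => i' _.
rewrite /UI; case: ifP => hi; last first.
  by rewrite big1 ?mul0r // => u _; rewrite mul0mx mulmx0 hs0r mulr0.
case: ifP => hi'; last first.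
  by rewrite big1 ?mulr0 ?mul0r // => u _; rewrite !mulmx0 hs0r mulr0.
rewrite !mul1r.
under eq_bigr do rewrite hs_adjr -mulmxA.
apply: corr_lower; first by rewrite !mul_unitarymx ?trmxC_unitary.
exact: nsq_mul_adj (Uu _ _) (UM hi hi').
Qed.

(** The bound obtained from the three norms, with t = 1 / (2 |A| n). The set I
need not be a subgroup: the multiplication rule is only applied to two elements
of I, and the result may lie outside of I. *)
Theorem approx_heisenberg_card : (#|I| ^ 2 <= 4 * #|A| ^ 3 * n)%N.
Proof.
pose t : R := (2 * NR * n%:R)^-1.
have t0 : 0 < t by rewrite invr_gt0 !mulr_gt0.
rewrite -(ler_nat R) natrX natrM natrM natrX -/NR.
apply: (dimension_arith NR0 nR0 qt_gt0 (erefl t)).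
apply: (le_trans (ler_wpM2l _ total_lower)); first by rewrite mulr_ge0 // ltW.
rewrite mulr_sumr /qt !mulr_sumr -big_split /=; apply: ler_sum => u uO.
have E : \sum_s \sum_j \sum_j'
      hsre (T u (j + j') s) (F u j (s + j') *m F' u j' s) =
    NR * complex.Re (\sum_j \sum_j' \sum_i \sum_i' om u (i * j') *
      hs (Q u *m U (i + i') (j + j')) (Q u *m (UI i j *m UI i' j'))).
  rewrite -Re_realM -NE -(total uO) Re_sum; apply: eq_bigr => s _.
  by rewrite Re_sum; apply: eq_bigr => j _; rewrite Re_sum.
have := conv_trilinear (F u) (F' u) (T u) t0.
rewrite (normF uO) (normF' uO) (normT uO) E mulrA.
move=> h; apply: (le_trans h); rewrite lerD2r ler_pM2l // le_eqVlt.
by apply/orP; left; apply/eqP; ring.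
Qed.

End DimensionBound.

(** * The characters of a cyclic group of order a power of two *)

Section CyclicCharacter.
Variables (C : numClosedFieldType) (k : nat) (z : C).
Local Open Scope ring_scope.
Hypothesis zL : z ^+ (2 ^ k) = -1.
Local Notation N := (2 ^ k.+1)%N.

Definition cyclic_char (x : 'Z_N) : C := z ^+ x.
Local Notation psi := cyclic_char.

Lemma two_power_gt1 : (1 < N)%N.
Proof. by rewrite expnS; have := expn_gt0 2 k; lia. Qed.
Local Notation N1 := two_power_gt1.

Lemma cyclic_root1 : z ^+ N = 1.
Proof. by rewrite expnS mulnC exprM zL sqrrN expr1n. Qed.

Lemma cyclic_char_nat n : psi n%:R = z ^+ n.
Proof. by rewrite /psi val_Zp_nat ?N1 // (expr_mod _ cyclic_root1). Qed.

Lemma cyclic_char0 : psi 0 = 1.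
Proof. by rewrite /psi expr0. Qed.

Lemma cyclic_charD x y : psi (x + y) = psi x * psi y.
Proof.
by rewrite -{1}(natr_Zp x) -{1}(natr_Zp y) -natrD cyclic_char_nat exprD.
Qed.

Lemma cyclic_char_conj x : (psi x)^* = psi (- x).
Proof.
have n1 : `|psi x| = 1.
  apply/eqP; rewrite -(@pexpr_eq1 _ _ N) //; last by rewrite expn_gt0.
  by rewrite -normrX -exprM mulnC exprM cyclic_root1 expr1n normr1.
have x0 : psi x != 0 by rewrite -normr_eq0 n1 oner_eq0.
apply: (mulfI x0); rewrite -normCK n1 expr1n -cyclic_charD subrr.
by rewrite cyclic_char0.
Qed.

(** The root of unity z is primitive: its order divides 2^(k+1) but not 2^k. *)
Lemma cyclic_char_neq1 x : x != 0 -> psi x != 1.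
Proof.
have N0 : (0 < N)%N by rewrite expn_gt0.
have [q qp] := prim_order_exists N0 cyclic_root1.
case/(dvdn_pfactor _ _ (isT : prime 2)) => j jk qE.
have {qE} qE : q = N.
  rewrite qE; move: jk; rewrite leq_eqVlt => /predU1P[->//|jk].
  have : (q %| 2 ^ k)%N by rewrite qE dvdn_exp2l.
  rewrite (prim_order_dvd qp) zL eq_sym -addr_eq0 -(natrD _ 1 1).
  by rewrite pnatr_eq0.
rewrite /psi -(prim_order_dvd qp) qE => x0; apply/negP => /dvdnP[t tE].
have := ltn_ord x; rewrite [X in (_ < X)%N]Zp_cast ?N1 // tE.
case: t tE => [tE|t _]; last by rewrite mulSn; lia.
by move: x0; rewrite -(natr_Zp x) tE mul0n eqxx.
Qed.

Lemma cyclic_char_sum x : x != 0 -> \sum_s psi (x * s) = 0.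
Proof.
move=> x0; have : (1 - psi x) * \sum_s psi (x * s) = 0.
  rewrite mulrBl mul1r [X in X - _](reindex_inj (addrI 1)) /= mulr_sumr -sumrB.
  by apply: big1 => s _; rewrite mulrDr mulr1 cyclic_charD subrr.
move/eqP; rewrite mulf_eq0 => /orP[|/eqP//].
by rewrite subr_eq0 eq_sym (negPf (cyclic_char_neq1 x0)).
Qed.

Definition cyclic_half : 'Z_N := (2 ^ k)%:R.

Lemma cyclic_halfD : cyclic_half + cyclic_half = 0.
Proof. by rewrite -natrD addnn -mul2n -expnS pchar_Zp ?N1. Qed.

(** A character that is -1 on the element of order 2 has an odd index, which is
invertible. *)
Lemma cyclic_half_reg u x :
  psi (u * cyclic_half) = -1 -> u * x = 0 -> x = 0.
Proof.
rewrite -{1}(natr_Zp u) -natrM cyclic_char_nat mulnC exprM zL => uO ux.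
suff uU : u \is a GRing.unit by apply: (mulrI uU); rewrite mulr0.
rewrite -(natr_Zp u) unitZpE ?N1 // coprime_sym coprimeXr //.
rewrite coprimen2; apply/negPn/negP => ue; move: uO.
rewrite -signr_odd (negPf ue) expr0 => /eqP.
by rewrite -addr_eq0 -(natrD _ 1 1) pnatr_eq0.
Qed.

End CyclicCharacter.

(** * The presented group and its action on triples *)

Section Presentation.
Local Open Scope group_scope.

Definition free_gen (S : choiceType) (s : S) : free_group S :=
  exist _ [:: (s, false)] isT.

Local Notation gen i := (free_gen (inord i : 'I_9)).
Local Notation a := (gen 0).
Local Notation b := (gen 1).
Local Notation c := (gen 2).
Local Notation e := (gen 3).
Local Notation f := (gen 4).
Local Notation g := (gen 5).
Local Notation d := (gen 6).
Local Notation h := (gen 7).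
Local Notation u := (gen 8).

Definition relators : seq (free_group 'I_9) :=
  [seq p.1 * p.2^-1 | p <- relations a b c e f g d h u].

(** The word for e14(1/2): the commutator of e12(1) and e24(1/2). *)
Definition half_word : free_group 'I_9 :=
  (d * b * d^-1)^-1 * a * (d * b * d^-1) * a^-1.

End Presentation.

Section Nontrivial.
Local Open Scope ring_scope.
Local Notation space := (rat * rat * rat)%type.

(** The affine action of the letters, in the order a, b, c, e, f, g, d, h, u. *)
Definition letter_act (x : 'I_9 * bool) (v : space) : space :=
  let: (p, q, r) := v in
  let s := (-1) ^+ x.2 in
  match val x.1 with
  | 0 => (p + s * q, q, r)
  | 1 => (p, q + s, r)
  | 2 => (p + s * r, q, r)
  | 3 => (p, q, r + s)
  | 4 => (p, q + s * r, r)
  | 5 => (p, q, r + s * q)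
  | 6 => (p, (if x.2 then q * 2 else q / 2), r)
  | 7 => (p, q, (if x.2 then r * 2 else r / 2))
  | _ => ((if x.2 then p / 3 else p * 3), q, r)
  end.

Lemma letter_actK x : cancel (letter_act (letter_inv x)) (letter_act x).
Proof.
case: x => [[i hi] s] [[p q] r]; rewrite /letter_act /letter_inv /=.
by do 9?[case: i hi => [|i] hi]; case: s; rewrite /=; congr (_, _, _); field.
Qed.

Definition word_act (w : free_group 'I_9) (v : space) : space :=
  foldr letter_act v (val w).

Lemma foldr_push_act (l : seq ('I_9 * bool)) x v :
  foldr letter_act v (push x l) = letter_act x (foldr letter_act v l).
Proof.
case: l => //= y l; case: eqP => //= ->.
by rewrite letter_actK.
Qed.

Lemma word_actM w1 w2 v : word_act (w1 * w2)%g v = word_act w1 (word_act w2 v).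
Proof.
rewrite /word_act /=; elim: (val w1) => //= x l <-; exact: foldr_push_act.
Qed.

Lemma word_actK w : cancel (word_act w^-1%g) (word_act w).
Proof. by move=> v; rewrite -word_actM mulgV. Qed.

Lemma word_actVK w : cancel (word_act w) (word_act w^-1%g).
Proof. by move=> v; rewrite -word_actM mulVg. Qed.

Definition shift m (v : space) : space := let: (p, q, r) := v in (p + m, q, r).

(** Membership in Z[1/3]. *)
Definition third_adic (m : rat) := exists n (z : int), m * 3 ^+ n = z%:~R.

Lemma third_adicD m n : third_adic m -> third_adic n -> third_adic (m + n).
Proof.
move=> [i [x xE]] [j [y yE]]; exists (i + j)%N, (x * 3 ^+ j + y * 3 ^+ i).
by rewrite rmorphD !rmorphM !rmorphXn /= -xE -yE exprD; ring.
Qed.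

Lemma third_adicN m : third_adic m -> third_adic (- m).
Proof. by move=> [i [x xE]]; exists i, (- x); rewrite mulNr xE rmorphN. Qed.

Lemma letter_act_shift x m : third_adic m ->
  exists2 m', third_adic m' &
    forall v, letter_act x (shift m v) = shift m' (letter_act x v).
Proof.
move=> mT.
suff [m' m'T mE] : exists2 m', third_adic m' &
    forall p q r, letter_act x (p + m, q, r) = shift m' (letter_act x (p, q, r)).
  by exists m' => // -[[p q] r]; rewrite -mE.
case: x => [[i hi] s]; rewrite /letter_act /=.
do 8?[case: i hi => [|i] hi];
  try by exists m => // p q r; rewrite /shift; congr (_, _, _); ring.
case: s; have [n [z zE]] := mT.
  exists (m / 3); last by move=> p q r; rewrite /shift; congr (_, _, _); field.
  by exists n.+1, z; rewrite -zE exprS; field.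
exists (m * 3); last by move=> p q r; rewrite /shift; congr (_, _, _); field.
by exists n, (z * 3); rewrite rmorphM /= -zE; ring.
Qed.

Lemma word_act_shift w m : third_adic m ->
  exists2 m', third_adic m' &
    forall v, word_act w (shift m v) = shift m' (word_act w v).
Proof.
rewrite /word_act => mT; elim: (val w) => [|x l [m' m'T IH]]; first by exists m.
have [m'' m''T xE] := letter_act_shift x m'T.
by exists m'' => // v /=; rewrite IH xE.
Qed.

Lemma shift_shift m n v : shift m (shift n v) = shift (n + m) v.
Proof. by case: v => -[p q] r /=; rewrite addrA. Qed.

Lemma shift0 v : shift 0 v = v.
Proof. by case: v => -[p q] r /=; rewrite addr0. Qed.

Lemma free_gen_act i v : word_act (free_gen i) v = letter_act (i, false) v.
Proof. by []. Qed.

Lemma free_genV_act i v : word_act (free_gen i)^-1%g v = letter_act (i, true) v.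
Proof. by []. Qed.

Lemma third_adic_nat n : third_adic n%:R.
Proof. by exists 0%N, n; rewrite expr0 mulr1. Qed.

(** The translation is 0 for all relators except the one of the pair (a, b), for
which it is 1. *)
Lemma relators_act r : r \in relators ->
  exists2 m, third_adic m & forall v, word_act r v = shift m v.
Proof.
case/mapP => -[x y] xy ->{r} /=.
suff [n E] : exists n : nat, forall v, word_act x v = shift n%:R (word_act y v).
  exists n%:R; first exact: third_adic_nat.
  by move=> v; rewrite word_actM E word_actK.
move: xy; rewrite /relations /commuting_pairs /equations /= !inE.
do !case/predU1P => [[-> ->]|];
  last (move=> /eqP[-> ->]);
  (first [exists 0%N; move=> [[p q] r];
   rewrite ?word_actM ?free_genV_act ?free_gen_act /letter_act /= !inordK //= /shift;
   by congr (_, _, _); field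
  | exists 1%N; move=> [[p q] r];
   rewrite ?word_actM ?free_genV_act ?free_gen_act /letter_act /= !inordK //= /shift;
   by congr (_, _, _); field]).
Qed.

(** The normal closure translates p by elements of Z[1/3], because the action of
any word maps such translations to each other; but 1/2 is not in Z[1/3], since
powers of 3 are odd. *)
Lemma half_word_neq1 : pres_pi relators half_word <> 1%g.
Proof.
have -> : 1%g = pres_pi relators 1%g by [].
move/esym/pres_piP; rewrite invg1 mul1g => hw.
suff [m [n [z zE]] mE] : exists2 m, third_adic m &
    forall v, word_act half_word v = shift m v.
  have := mE (0, 0, 0); rewrite /half_word.
  rewrite ?invgM ?invgK ?word_actM ?free_genV_act ?free_gen_act /letter_act /=.
  rewrite !inordK //= => -[m2]; move: zE.
  rewrite (_ : m = 2^-1); last by rewrite -[LHS]add0r -m2; field.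
  move=> E; have : (3 ^+ n)%:~R = (z * 2)%:~R :> rat.
    by rewrite rmorphM rmorphXn /= -E; field.
  move/intr_inj => {}E.
  have := congr1 (fun x => odd `|x|) E.
  by rewrite abszM abszX oddM andbF oddX orbT.
elim: hw => [r /relators_act//| |x y _ [m mT mE] _ [n nT nE]|x _ [m mT mE]|].
- by exists 0 => [|v]; rewrite ?shift0 //; exact: (third_adic_nat 0).
- exists (n + m); first exact: third_adicD.
  by move=> v; rewrite word_actM nE mE shift_shift.
- exists (- m); first exact: third_adicN.
  by move=> v; rewrite -[RHS](word_actVK x) mE shift_shift addNr shift0.
move=> x t _ [m mT mE]; have [m' m'T tE] := word_act_shift t^-1%g mT.
by exists m' => // v; rewrite !word_actM mE tE word_actVK.
Qed.

End Nontrivial.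

(** * Lower bound for the hyperlinear profile *)

Section UnitaryApproximation.
Local Open Scope ring_scope.
Variables (R : realType) (G : groupType) (d : nat).
Variable phi : {multiplicative G -> unitary_group R[i] d}.
Variable eps : R.
Hypotheses (d0 : (0 < d)%N) (eps0 : 0 <= eps).
Implicit Types A B : 'M[R[i]]_d.

Lemma fnormE A : fnorm A = Num.sqrt (nsq A) / Num.sqrt d%:R.
Proof.
by rewrite /fnorm -/(nsq A) sqrtrM ?nsq_ge0 // sqrtrV.
Qed.

Lemma fnorm_ge A r : 0 <= r -> r <= fnorm A -> r ^+ 2 * d%:R <= nsq A.
Proof.
move=> r0; rewrite /fnorm -/(nsq A) => h.
rewrite -ler_pdivlMr ?ltr0n // -(sqr_sqrtr (divr_ge0 (nsq_ge0 A) (ler0n R d))).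
by rewrite lerXn2r ?nnegrE ?sqrtr_ge0.
Qed.

Lemma fnorm_le A r : 0 <= r -> fnorm A <= r -> nsq A <= r ^+ 2 * d%:R.
Proof.
move=> r0; rewrite /fnorm -/(nsq A) => h.
rewrite -ler_pdivrMr ?ltr0n // -(sqr_sqrtr (divr_ge0 (nsq_ge0 A) (ler0n R d))).
by rewrite lerXn2r ?nnegrE ?sqrtr_ge0.
Qed.

Lemma fnormD A B : fnorm (A + B) <= fnorm A + fnorm B.
Proof.
rewrite !fnormE -mulrDl ler_wpM2r ?invr_ge0 ?sqrtr_ge0 //; exact: sqrt_nsqD.
Qed.

Lemma fnormN A : fnorm (- A) = fnorm A.
Proof. by rewrite !fnormE nsqN. Qed.

Lemma fnorm_unitaryl (U : unitary_group R[i] d) A : fnorm (val U *m A) = fnorm A.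
Proof. by rewrite !fnormE nsq_unitaryl // (valP U). Qed.

Lemma fnorm_unitaryr (U : unitary_group R[i] d) A : fnorm (A *m val U) = fnorm A.
Proof. by rewrite !fnormE nsq_unitaryr // (valP U). Qed.

(** Distances of unitaries are invariant under multiplications, hence the errors
of factors add up. *)
Definition unitary_ap (n : nat) (x y : G) : Prop :=
  fnorm (val (phi x) - val (phi y)) <= n%:R * eps.

Fact unitary_ap_refl x : unitary_ap 0 x x.
Proof.
rewrite /unitary_ap subrr fnormE.
by rewrite -(scale0r 0) -(rmorph0 (real_complex R)) nsqZ expr0n !mul0r sqrtr0 mul0r.
Qed.

Fact unitary_ap_sym n x y : unitary_ap n x y -> unitary_ap n y x.
Proof. by rewrite /unitary_ap -fnormN opprB. Qed.

Fact unitary_ap_trans m n x y z :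
  unitary_ap m x y -> unitary_ap n y z -> unitary_ap (m + n) x z.
Proof.
rewrite /unitary_ap natrD mulrDl => xy yz.
by rewrite -(subrKA (val (phi y))) (le_trans (fnormD _ _)) // lerD.
Qed.

Fact unitary_ap_leq m n x y : (m <= n)%N -> unitary_ap m x y -> unitary_ap n x y.
Proof.
by move=> mn /le_trans; apply; rewrite ler_wpM2r // ler_nat.
Qed.

Fact unitary_ap_mul m n x y x' y' : unitary_ap m x y -> unitary_ap n x' y' ->
  unitary_ap (m + n) (x * x')%g (y * y')%g.
Proof.
rewrite /unitary_ap natrD mulrDl => xy xy'; rewrite !gmulfM /=.
have -> : val (phi x) *m val (phi x') - val (phi y) *m val (phi y') =
    (val (phi x) - val (phi y)) *m val (phi x') +
    val (phi y) *m (val (phi x') - val (phi y')).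
  by rewrite mulmxBl mulmxBr addrA subrK.
apply: (le_trans (fnormD _ _)).
by rewrite fnorm_unitaryl fnorm_unitaryr lerD.
Qed.

Definition unitary_approx : approx_congruence G :=
  ApproxCongruence unitary_ap_refl unitary_ap_sym unitary_ap_trans
    unitary_ap_leq unitary_ap_mul.

End UnitaryApproximation.

Lemma card_ord_lt n l : l <= n -> #|[set x : 'I_n | x < l]| = l.
Proof.
move=> ln; rewrite -sum1_card; under eq_bigl do rewrite inE.
by rewrite (big_ord_narrow ln) sum1_card card_ord.
Qed.

Fact quartic_cancel l n :
  0 < l -> (l * l) ^ 2 <= 4 * (2 * l) ^ 3 * n -> l <= 32 * n.
Proof.
move=> l0; have -> : (l * l) ^ 2 = l ^ 3 * l by ring.
have -> : 4 * (2 * l) ^ 3 * n = l ^ 3 * (32 * n) by ring.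
by rewrite leq_pmul2l // expn_gt0 l0.
Qed.

Section ProfileBound.
Local Open Scope ring_scope.
Variable R : realType.

Local Notation gen i := (free_gen (inord i : 'I_9)).
Local Notation a := (gen 0).
Local Notation b := (gen 1).
Local Notation d := (gen 6).

(** The Heisenberg group over Z/2^(k+1). The indices i, j of I are below 2^k, so
that their sums do not wrap around: e12 and e24 have infinite order. *)
Lemma rep_dim_lower (n k : nat) (eps delta : R)
    (phi : {multiplicative free_group 'I_9 -> unitary_group R[i] n}) :
  (0 < n)%N -> (0 < k)%N -> 0 <= eps -> 0 < delta ->
  eps_representation relators eps phi ->
  delta <= fnorm (val (phi half_word) - 1%:M) ->
  6 * ((200 * 100 * k.+1.*2 ^ 4)%:R * eps) <= delta ->
  (2 ^ k <= 32 * n)%N.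
Proof.
move=> n0 k0 eps0 delta0 repphi wdelta small.
set m := k.+1 in small *; set K := m.*2 in small *.
set eta := _ * eps in small.
have eta0 : 0 <= eta by rewrite mulr_ge0.
pose E := unitary_approx phi eps0.
have rel p :
    p \in relations a b (gen 2) (gen 3) (gen 4) (gen 5) d (gen 7) (gen 8) ->
    ap E 1 p.1 p.2.
  move=> pr; have := repphi (p.1 * p.2^-1)%g (map_f _ pr).
  rewrite /= /unitary_ap mul1r -(fnorm_unitaryr (phi p.2)) mulmxBl mul1mx.
  by rewrite -[X in X - _]/(val (phi _ * phi _)%g) -gmulfM mulgVK.
have [z zL] : exists z : R[i], z ^+ (2 ^ k) = -1.
  by exists ((2 ^ k).-root (-1)); rewrite rootCK // expn_gt0.
pose Y (l : 'Z_(2 ^ m)) := val (phi (e14w a b d m l)).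
pose U (i j : 'Z_(2 ^ m)) := val (phi (e24w b d m j * e12w a d i)%g).
pose I := [set p : 'Z_(2 ^ m) * 'Z_(2 ^ m) | (p.1 < 2 ^ k)%N && (p.2 < 2 ^ k)%N].
have N1 := two_power_gt1 k.
have ltN (x : 'Z_(2 ^ m)) : (x < 2 ^ m)%N.
  by have := ltn_ord x; rewrite [X in (_ < X)%N]Zp_cast.
have valD (x y : 'Z_(2 ^ m)) : val (x + y) = ((x + y) %% 2 ^ m)%N.
  by rewrite /= [X in (_ %% X)%N]Zp_cast.
have valM (x y : 'Z_(2 ^ m)) : val (x * y) = ((x * y) %% 2 ^ m)%N.
  by rewrite /= [X in (_ %% X)%N]Zp_cast.
have mlK : (2 * 2 ^ m < 2 ^ K)%N.
  by rewrite -expnS ltn_exp2l // /K -addnn; lia.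
have K0 : (0 < K)%N by [].
have mK : (m <= K)%N by rewrite /K -addnn leq_addr.
have YM l l' : nsq (Y l *m Y l' - Y (l + l')) <= eta ^+ 2 * n%:R.
  apply: fnorm_le => //.
  have := e14w_mod_add rel K0 mK mlK (ltN l) (ltN l').
  by rewrite /= /unitary_ap gmulfM /Y valD.
have UM i j i' j' : (i, j) \in I -> (i', j') \in I ->
    nsq (U i j *m U i' j' - Y (i * j') *m U (i + i') (j + j'))
      <= eta ^+ 2 * n%:R.
  rewrite !inE /= => /andP[ik jk] /andP[ik' jk']; apply: fnorm_le => //.
  have addk (x y : 'Z_(2 ^ m)) : (x < 2 ^ k)%N -> (y < 2 ^ k)%N ->
      val (x + y) = (x + y)%N.
    by move=> xk yk; rewrite valD modn_small //; have := expnS 2 k; rewrite -/m; lia.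
  have := heisenberg_mul rel K0 mK (leqnn _) mlK
    (ltN i) (ltN j) (ltN i') (ltN j').
  by rewrite /= /unitary_ap gmulfM [phi (e14w _ _ _ _ _ * _)%g]gmulfM /Y /U valM
    !addk.
have YL : delta ^+ 2 * n%:R <= nsq (Y (cyclic_half k) - 1%:M).
  apply: (fnorm_ge n0 (ltW delta0)); rewrite /Y.
  have -> : nat_of_ord (cyclic_half k) = (2 ^ k)%N.
    by rewrite /cyclic_half val_Zp_nat // modn_small // ltn_exp2l.
  by rewrite (e14w_half _ _ _ (erefl m)).
have Yu l : Y l \is unitarymx by exact: valP.
have Uu i j : U i j \is unitarymx by exact: valP.
have nR0 : (0 : R) < n%:R by rewrite ltr0n.
have D0 : 0 < delta ^+ 2 * n%:R by rewrite mulr_gt0 ?exprn_gt0.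
have eD : 36 * (eta ^+ 2 * n%:R) <= delta ^+ 2 * n%:R.
  rewrite mulrA ler_pM2r // (_ : 36 * eta ^+ 2 = (6 * eta) ^+ 2); last by ring.
  by rewrite lerXn2r ?nnegrE ?mulr_ge0 // ltW.
have := approx_heisenberg_card (cyclic_char0 k z) (cyclic_charD zL)
  (cyclic_char_conj zL) (cyclic_char_sum zL) (cyclic_halfD k)
  (cyclic_half_reg zL) n0 D0 eD Yu Uu YM UM YL.
have -> : #|I| = (2 ^ k * 2 ^ k)%N.
  have -> : I = setX [set x : 'Z_(2 ^ m) | (x < 2 ^ k)%N]
      [set x : 'Z_(2 ^ m) | (x < 2 ^ k)%N].
    by apply/setP=> -[x y]; rewrite !inE.
  by rewrite cardsX !card_ord_lt // Zp_cast // leq_exp2l.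
rewrite card_ord Zp_cast // /m (expnS 2 k).
by apply: quartic_cancel; rewrite expn_gt0.
Qed.

End ProfileBound.

Local Open Scope ring_scope.

Theorem theorem1p2 (R : realType) :
  exists (S : finType) (Rel : seq (free_group S)) (w : free_group S),
    pres_pi Rel w <> 1%g /\
    exists alpha C C' : R,
      [/\ 0 < alpha, 0 < C, 0 < C' &
        forall eps delta : R, 0 < eps -> 0 < delta ->
          ((C' * expR (C * (delta / eps) `^ alpha))%:E
             <= hlp Rel w delta eps)%E].
Proof.
exists 'I_9, relators, half_word; split; first exact: half_word_neq1.
have ln2 : 0 < ln 2 :> R by rewrite ln_gt0 // ltr1n.
(* The constant 38 is chosen so that 6 * 20000 * 16 <= 38 ^ 4; the factor 16 is
   the fourth power of the 2 in the bound 2 m for the number of digits. *)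
exists 4^-1, (ln 2 / 38), 128^-1; split; rewrite ?divr_gt0 ?invr_gt0 //.
move=> eps delta eps0 delta0; rewrite /hlp.
case: pselect => [ex_d|_]; last exact: leey.
case: ex_minnP => n /asboolP[n0 [phi [repphi wdelta]]] _; rewrite lee_fin.
set x := _ `^ _; have x0 : 0 <= x by exact: powR_ge0.
have x4 : x ^+ 4 * eps = delta.
  rewrite /x -powR_mulrn ?powR_ge0 // -powRrM mulVf ?pnatr_eq0 //.
  by rewrite powRr1 ?divr_ge0 ?ltW // divfK ?gt_eqF.
have y0 : 0 <= x / 38 by rewrite divr_ge0.
have /andP[] := truncn_itv y0; set m := Num.truncn _ => my ym.
have mn : (2 ^ m <= 64 * n)%N.
  case: m my {ym} => [|[|k]] my; [by rewrite expn0; lia|by rewrite expn1; lia|].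
  rewrite expnS; suff : (2 ^ k.+1 <= 32 * n)%N by lia.
  apply: (rep_dim_lower n0 _ (ltW eps0) delta0 repphi wdelta) => //.
  rewrite -x4 mulrA; apply: ler_wpM2r; first exact: ltW.
  apply: (@le_trans _ _ ((38 * k.+2%:R) ^+ 4)).
    rewrite -[k.+2.*2]muln2 natrM natrX (natrM _ 200) (natrM _ k.+2) !exprMn.
    have : 0 <= (k.+2%:R : R) ^+ 4 by rewrite exprn_ge0.
    move: (_ ^+ 4) => t t0; lra.
  rewrite lerXn2r ?nnegrE ?mulr_ge0 //.
  by rewrite mulrC -ler_pdivlMr.
rewrite mulrC ler_pdivrMr //.
apply: (@le_trans _ _ (2 ^+ m.+1)).
  rewrite -[leRHS](congr1 (fun t => t ^+ m.+1) (lnK _)) ?posrE //.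
  rewrite -expRM_natr ler_expR -mulrA ler_pM2l //.
  by rewrite mulrC ltW.
rewrite -natrX -natrM ler_nat expnS; lia.
Qed.
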